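(* Let $(K,\delta)$ be a differential field (arbitrary characteristic). The following are equivalent: (1) $(K,\delta)$ is separably differentially closed; (2) whenever $V$ and $W$ are $K$-irreducible affine varieties over $K$ with $W\subseteq\tau V$, $W$ separable, and $\pi|_W:W\to V$ separable, and $O_V$, $O_W$ are nonempty Zariski-open subsets over $K$ of $V$ and $W$ respectively, there is a $K$-rational point $a\in O_V$ such that $(a,\delta a)\in O_W$.
   Context: $(K,\delta)$ is separably differentially closed if it is existentially closed (language of differential fields) in every differential field extension $(L,\delta)$ with $L/K$ separable as a field extension. For an affine variety $V\subseteq\mathbb{A}^n$ over $K$ with defining radical ideal $I\subseteq K[x_1,\dots,x_n]$, its prolongation $\tau V\subseteq\mathbb{A}^{2n}$ is defined by the equations $f(\bar x)=0$ and $\sum_{i=1}^n\frac{\partial f}{\partial x_i}(\bar x)y_i+f^\delta(\bar x)=0$ for $f$ ranging over generators of $I$, where $f^\delta$ is obtained by applying $\delta$ to the coefficients of $f$; $\pi:\tau V\to V$ is the projection $(\bar x,\bar y)\mapsto\bar x$. A $K$-irreducible variety $V$ is separable if its function field $K(V)$ is separable over $K$; a morphism $\phi:W\to V$ of $K$-irreducible varieties is separable if it is dominant and $K(W)$ is separable over $\phi^*(K(V))$. *)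

(* Defs.v *)
From HB Require Import structures.
From mathcomp Require Import all_boot all_order all_algebra.
From mathcomp Require Import boolp.
From mathcomp Require Import mpoly.

Set Implicit Arguments.
Unset Strict Implicit.
Unset Printing Implicit Defensive.

Import GRing.Theory.
Local Open Scope ring_scope.
Local Open Scope quotient_scope.

Definition derivation (K : fieldType) (delta : K -> K) : Prop :=
  {morph delta : x y / x + y} /\
  forall x y, delta (x * y) = delta x * y + x * delta y.

Definition lin_indep (L : fieldType) (S : L -> Prop) (m : nat)
    (b : 'I_m -> L) : Prop :=
  forall c : 'I_m -> L, (forall i, S (c i)) ->
    \sum_i c i * b i = 0 -> forall i, c i = 0.

(* Separability of a not necessarily algebraic extension L of a subfield k:
   for p = char L > 0, the fields k and L^p are linearly disjoint over k^p
   (the image under Frobenius of: k^(1/p) and L are linearly disjoint over k).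
   In characteristic 0 the set [pchar L] is empty. *)
Definition separable_over (L : fieldType) (k : L -> Prop) : Prop :=
  forall p, p \in [pchar L] ->
  forall (m : nat) (b : 'I_m -> L), (forall i, k (b i)) ->
    lin_indep (fun c => exists2 d, k d & c = d ^+ p) b ->
    lin_indep (fun c => exists d, c = d ^+ p) b.

Section ExistentiallyClosed.
Variable K : fieldType.

(* Terms and quantifier-free formulas, with parameters in K, of the language
   {0, 1, +, -, *, ^-1, delta}; the constants 0 and 1 are parameters, and
   0^-1 = 0. *)
Inductive dterm : Type :=
  | DVar of nat
  | DConst of K
  | DAdd of dterm & dterm
  | DOpp of dterm
  | DMul of dterm & dterm
  | DInv of dterm
  | DDelta of dterm.

Inductive dformula : Type :=
  | DEq of dterm & dterm
  | DNot of dformula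
  | DAnd of dformula & dformula
  | DOr of dformula & dformula.

Section Semantics.
Variables (L : fieldType) (deltaL : L -> L) (j : K -> L) (e : nat -> L).

Fixpoint deval (t : dterm) : L :=
  match t with
  | DVar i => e i
  | DConst c => j c
  | DAdd t1 t2 => deval t1 + deval t2
  | DOpp t1 => - deval t1
  | DMul t1 t2 => deval t1 * deval t2
  | DInv t1 => (deval t1)^-1
  | DDelta t1 => deltaL (deval t1)
  end.

Fixpoint dholds (phi : dformula) : Prop :=
  match phi with
  | DEq t1 t2 => deval t1 = deval t2
  | DNot phi1 => ~ dholds phi1
  | DAnd phi1 phi2 => dholds phi1 /\ dholds phi2
  | DOr phi1 phi2 => dholds phi1 \/ dholds phi2
  end.
End Semantics.

Definition existentially_closed_in (delta : K -> K) (L : fieldType)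
    (deltaL : L -> L) (j : K -> L) : Prop :=
  forall phi : dformula,
    (exists e : nat -> L, dholds deltaL j e phi) ->
    exists e : nat -> K, dholds delta id e phi.

Definition separably_differentially_closed (delta : K -> K) : Prop :=
  forall (L : fieldType) (deltaL : L -> L) (j : {rmorphism K -> L}),
    derivation deltaL ->
    (forall x, deltaL (j x) = j (delta x)) ->
    separable_over (fun z => exists c, z = j c) ->
    existentially_closed_in delta deltaL j.

End ExistentiallyClosed.

Section Varieties.
Variables (K : fieldType) (Omega : closedFieldType).
Variable iota : {rmorphism K -> Omega}.

(* Closed sets are sets of points with coordinates in the algebraically closed
   extension Omega of K, cut out by polynomials over K. *)
Definition K_closed (n : nat) (A : ('I_n -> Omega) -> Prop) : Prop :=
  exists S : {mpoly K[n]} -> Prop,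
    forall x, A x <-> (forall f, S f -> mmap iota x f = 0).

Definition K_irreducible (n : nat) (V : ('I_n -> Omega) -> Prop) : Prop :=
  [/\ K_closed V, exists x, V x &
      forall A B, K_closed A -> K_closed B ->
        (forall x, V x -> A x \/ B x) ->
        (forall x, V x -> A x) \/ (forall x, V x -> B x)].

Record irr_variety (n : nat) := IrrVariety {
  points :> ('I_n -> Omega) -> Prop;
  points_irreducible : K_irreducible points
}.

Definition nonempty_K_open (n : nat) (V O : ('I_n -> Omega) -> Prop) : Prop :=
  (exists x, O x) /\
  exists2 C, K_closed C & forall x, O x <-> V x /\ ~ C x.

Definition vanishing_ideal (n : nat) (V : ('I_n -> Omega) -> Prop)
    (f : {mpoly K[n]}) : Prop :=
  forall x, V x -> mmap iota x f = 0.

(* Taking all f in the ideal, rather than generators, defines the same set. *)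
Definition prolongation (delta : K -> K) (n : nat) (V : ('I_n -> Omega) -> Prop)
    (z : 'I_(n + n) -> Omega) : Prop :=
  let x i := z (lshift n i) in
  let y i := z (rshift n i) in
  forall f, vanishing_ideal V f ->
    mmap iota x f = 0 /\
    \sum_(i < n) mmap iota x f^`M(i) * y i + mmap iota x (map_mpoly delta f)
      = 0.

Section FunctionField.
Variables (n : nat) (V : irr_variety n).

Definition ideal_pred (f : {mpoly K[n]}) : bool := `[< vanishing_ideal V f >].

Lemma ideal_predP f : reflect (vanishing_ideal V f) (f \in ideal_pred).
Proof. exact: asboolP. Qed.

Lemma ideal_pred_idealr : idealr_closed ideal_pred.
Proof.
split.
- by apply/ideal_predP => x _; rewrite rmorph0.
- apply/negP => /ideal_predP h.
  have [_ [x Vx] _] := points_irreducible V.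
  by move/eqP: (h x Vx); rewrite rmorph1 oner_eq0.
- move=> a u v /ideal_predP hu /ideal_predP hv; apply/ideal_predP => x Vx.
  by rewrite rmorphD rmorphM /= hu // hv // mulr0 addr0.
Qed.

HB.instance Definition _ :=
  isIdealr.Build {mpoly K[n]} ideal_pred ideal_pred_idealr.

Lemma ideal_pred_prime : prime_idealr_closed ideal_pred.
Proof.
move=> u v /ideal_predP huv.
have closed1 (w : {mpoly K[n]}) : K_closed (fun x => mmap iota x w = 0).
  by exists (fun f => f = w) => x; split=> [h f -> //|]; apply.
have [_ _ irr] := points_irreducible V.
have [|h|h] := irr _ _ (closed1 u) (closed1 v).
- move=> x Vx; have /eqP := huv x Vx; rewrite rmorphM mulf_eq0.
  by case/orP => /eqP; [left|right].
- by apply/orP; left; apply/ideal_predP.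
- by apply/orP; right; apply/ideal_predP.
Qed.

HB.instance Definition _ :=
  isPrimeIdealrClosed.Build {mpoly K[n]} ideal_pred ideal_pred_prime.

Definition defining_ideal : prime_idealr {mpoly K[n]} := ideal_pred.

Definition coord_ring : Type := {ideal_quot defining_ideal}.
HB.instance Definition _ := GRing.ComNzRing.on coord_ring.

Definition coord_unit : {pred coord_ring} :=
  fun u => `[< exists v, v * u = 1 >].

Definition coord_inv (u : coord_ring) : coord_ring :=
  if pselect (exists v, v * u = 1) is left h then sval (cid h) else u.

Lemma coord_mulVx : {in coord_unit, left_inverse 1 coord_inv *%R}.
Proof.
move=> u /asboolP hu; rewrite /coord_inv.
by case: pselect => // h; case: cid.
Qed.

Lemma coord_unitPl (u v : coord_ring) : v * u = 1 -> coord_unit u.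
Proof. by move=> h; apply/asboolP; exists v. Qed.

Lemma coord_inv_out : {in [predC coord_unit], coord_inv =1 id}.
Proof.
move=> u /asboolPn hu; rewrite /coord_inv.
by case: pselect.
Qed.

HB.instance Definition _ := GRing.ComNzRing_hasMulInverse.Build coord_ring
  coord_mulVx coord_unitPl coord_inv_out.

Lemma coord_ring_integral : GRing.integral_domain_axiom coord_ring.
Proof. exact: Quotient.rquot_IdomainAxiom. Qed.

HB.instance Definition _ :=
  GRing.ComUnitRing_isIntegral.Build coord_ring coord_ring_integral.

Definition function_field : fieldType := {fraction coord_ring}.

Definition rational_class (f : {mpoly K[n]}) : function_field :=
  FracField.tofrac (\pi_{ideal_quot defining_ideal} f : coord_ring).

Definition separable_variety : Prop :=
  separable_over (fun z : function_field =>
    exists c : K, z = rational_class c%:MP).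

End FunctionField.

Section Morphism.
Variables (m n : nat) (W : irr_variety m) (V : irr_variety n).
(* A morphism W -> V is given by n polynomials over K in m variables. *)
Variable phi : n.-tuple {mpoly K[m]}.

Definition image_point (z : 'I_m -> Omega) : 'I_n -> Omega :=
  fun i => mmap iota z (tnth phi i).

Definition is_morphism : Prop := forall z, W z -> V (image_point z).

Definition dominant : Prop :=
  forall C, K_closed C -> (forall z, W z -> C (image_point z)) ->
    forall x, V x -> C x.

(* The subfield phi^*(K(V)) of K(W), whose elements are the
   phi^*(f / g) = (f o phi) / (g o phi) for f / g in K(V). *)
Definition pullback_field (u : function_field W) : Prop :=
  exists f g : {mpoly K[n]}, ~ vanishing_ideal V g /\
    u = rational_class W (f \mPo phi) / rational_class W (g \mPo phi).

Definition separable_morphism : Prop :=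
  [/\ is_morphism, dominant & separable_over pullback_field].

End Morphism.

Definition proj_first (n : nat) : n.-tuple {mpoly K[n + n]} :=
  [tuple 'X_(lshift n i) | i < n].

End Varieties.

Definition with_delta (K : fieldType) (delta : K -> K) (n : nat)
    (a : 'I_n -> K) : 'I_(n + n) -> K :=
  fun k => match split k with inl i => a i | inr i => delta (a i) end.

(* Main.v *)
From HB Require Import structures.
Require Import Defs.
From mathcomp Require Import all_boot all_order all_algebra.
From mathcomp Require Import boolp.
From mathcomp Require classical_sets.
From mathcomp Require Import mpoly ring.

(** (1) => (2). The generic point (x, y) of W satisfies the equations of the
    prolongation of V, so delta together with x |-> y is a derivation from the
    pullback of K(V) into K(W). In characteristic p, separability is linear
    disjointness, which lets one extend it L^p-linearly to the compositum with
    L^p (L = K(W)); from there, as in characteristic 0, it extends one element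
    at a time, to all of L by Zorn's lemma. Membership in the open subsets is
    expressed by finitely many polynomial conditions (Hilbert's basis theorem),
    which (1) carries from K(W) down to K.

    (2) => (1). Let b list the values in L of all subterms of a formula true in
    L, and let F = K(b). An F-linear retraction of L onto F composed with deltaL
    is a derivation F -> F which agrees with deltaL wherever both an element and
    its derivative occur in b. With u the image of b under it, let V and W be the
    loci of b and (b, u): then K(W) = K(V) = F, so the projection is trivially
    separable, although K(b, deltaL b) need not be separable over K(b). A point
    (a, delta a) of W with a_i <> a_k whenever b_i <> b_k satisfies the formula.
    That the loci have the expected function fields is the Nullstellensatz,
    proved by specializing one coordinate at a time. *)

Set Implicit Arguments.
Unset Strict Implicit.
Unset Printing Implicit Defensive.
Import GRing.Theory.
Local Open Scope ring_scope.
Local Open Scope quotient_scope.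

(** * Hilbert basis theorem *)

Definition is_ideal (R : comNzRingType) (I : R -> Prop) : Prop :=
  [/\ I 0, (forall x y, I x -> I y -> I (x + y)) & forall a x, I x -> I (a * x)].

(** Finite generation in the form of minimality, so that explicit linear combinations never have to
    be handled. *)
Definition noetherian (R : comNzRingType) : Prop :=
  forall I : R -> Prop, is_ideal I ->
  exists2 s : seq R, (forall x, x \in s -> I x) &
    forall J, is_ideal J -> (forall x, x \in s -> J x) -> forall x, I x -> J x.

Lemma noetherian_field (F : fieldType) : noetherian F.
Proof.
move=> I [I0 _ IM].
case: (pselect (exists2 x, I x & x != 0)) => [[x Ix nx]|noI].
  exists [:: x] => [y|J [_ _ JM] Js y _]; first by rewrite inE => /eqP ->.
  by rewrite -[y](divfK nx); apply/JM/Js; rewrite inE.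
exists [::] => // J [J0 _ _] _ x Ix.
have [->//|nx] := eqVneq x 0; by case: noI; exists x.
Qed.

Lemma noetherian_surj (R S : comNzRingType) (h : {rmorphism R -> S}) :
  (forall y, exists x, h x = y) -> noetherian R -> noetherian S.
Proof.
move=> surj noR I [I0 ID IM].
have [|s sI sJ] := noR (fun x => I (h x)).
  split; first by rewrite rmorph0.
    by move=> x y; rewrite rmorphD; apply: ID.
  by move=> a x; rewrite rmorphM; apply: IM.
exists (map h s) => [_ /mapP[x xs ->]|J [J0 JD JM] Js y]; first exact: sI.
have [x <-] := surj y; apply: (sJ (fun x => J (h x))).
  split; first by rewrite rmorph0.
    by move=> {}x z; rewrite rmorphD; apply: JD.
  by move=> a z; rewrite rmorphM; apply: JM.
by move=> z zs; apply/Js/map_f.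
Qed.

Section HilbertBasis.
Variable R : comNzRingType.

(** The size bound is an inequality, so that 0 is included; for an ideal [I] these coefficients then
    form an ideal that grows with [d]. *)
Definition coef_ideal (I : {poly R} -> Prop) (d : nat) (a : R) : Prop :=
  exists f : {poly R}, [/\ I f, (size f <= d.+1)%N & f`_d = a].

Lemma coef_ideal_ideal (I : {poly R} -> Prop) d :
  is_ideal I -> is_ideal (coef_ideal I d).
Proof.
move=> [I0 ID IM]; split.
- by exists 0; rewrite size_poly0 coef0.
- move=> _ _ [f [If sf <-]] [g [Ig sg <-]]; exists (f + g); split.
  + exact: ID.
  + by apply: leq_trans (size_polyD _ _) _; rewrite geq_max sf.
  + by rewrite coefD.
- move=> a _ [f [If sf <-]]; exists (a%:P * f); split.
  + exact: IM.
  + by rewrite mul_polyC; apply: leq_trans (size_scale_leq _ _) _.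
  + by rewrite coefCM.
Qed.

Lemma coef_idealS (I : {poly R} -> Prop) d e a :
  is_ideal I -> (d <= e)%N -> coef_ideal I d a -> coef_ideal I e a.
Proof.
move=> [_ _ IM] de [f [If sf <-]]; exists ('X^(e - d) * f); split.
- exact: IM.
- apply: leq_trans (size_polyMleq _ _) _; rewrite size_polyXn /=.
  by apply: leq_trans (leq_add (leqnn _) sf) _; rewrite addnS subnK.
- by rewrite coefXnM ltnNge leq_subr /= subKn.
Qed.

(** The leading coefficients of [I] form an ideal of [R], whose finitely many generators all occur
    in some degree [N]. Generators of the coefficient ideals in degrees up to [N] lift to a finite
    list [t]; a member of [I] then loses its leading term by subtraction of an element of the ideal
    of [t]. *)
Lemma noetherian_poly : noetherian R -> noetherian {poly R}.
Proof.
move=> noR I idI; have [I0 ID IM] := idI.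
pose LC a := exists d, coef_ideal I d a.
have idLC : is_ideal LC.
  split=> [|a b [d Ia] [e Ib]|a b [d Ib]].
  - by exists 0%N; have [] := coef_ideal_ideal 0 idI.
  - exists (maxn d e); have [_ + _] := coef_ideal_ideal (maxn d e) idI; apply.
      by apply: coef_idealS Ia => //; apply: leq_maxl.
    by apply: coef_idealS Ib => //; apply: leq_maxr.
  - by exists d; have [_ _] := coef_ideal_ideal d idI; apply.
have [s sLC sJ] := noR _ idLC.
have [N sN] : exists N, forall a, a \in s -> coef_ideal I N a.
  elim: s sLC {sJ} => [|a s IHs] sLC; first by exists 0%N.
  have [|N sN] := IHs; first by move=> b bs; apply: sLC; rewrite inE bs orbT.
  have [d Ia] := sLC a (mem_head _ _).
  exists (maxn N d) => b; rewrite inE => /predU1P[->|/sN Ib].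
    by apply: coef_idealS Ia => //; apply: leq_maxr.
  by apply: coef_idealS Ib => //; apply: leq_maxl.
have gens d : exists t : seq {poly R},
    (forall f, f \in t -> I f /\ (size f <= d.+1)%N) /\
    forall J, is_ideal J -> (forall f, f \in t -> J f`_d) ->
      forall a, coef_ideal I d a -> J a.
  have [r rI rJ] := noR _ (coef_ideal_ideal d idI).
  have [t [tI tr]] : exists t : seq {poly R},
      (forall f, f \in t -> I f /\ (size f <= d.+1)%N) /\
      forall a, a \in r -> exists2 f, f \in t & f`_d = a.
    elim: r rI {rJ} => [|a r IHr] rI; first by exists [::].
    have [|t [tI tr]] := IHr; first by move=> b br; apply: rI; rewrite inE br orbT.
    have [f [If sf fa]] := rI a (mem_head _ _).
    exists (f :: t); split=> [g|b]; rewrite inE => /predU1P[->//|].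
    - exact: tI.
    - by exists f; rewrite ?mem_head.
    - by move=> /tr[g gt gb]; exists g; rewrite // inE gt orbT.
  exists t; split=> // J idJ tJ; apply: rJ => // a /tr[f ft <-]; exact: tJ.
have [t [tI tJ]] : exists t : seq {poly R}, (forall f, f \in t -> I f) /\
    forall d, (d <= N)%N -> exists u : seq {poly R},
     [/\ forall f, f \in u -> f \in t,
         forall f, f \in u -> (size f <= d.+1)%N &
         forall J, is_ideal J -> (forall f, f \in u -> J f`_d) ->
           forall a, coef_ideal I d a -> J a].
  elim: N {sN} => [|N [t [tI tJ]]].
    have [t [tI tJ]] := gens 0%N; exists t; split=> [f /tI[]//|d].
    by rewrite leqn0 => /eqP ->; exists t; split=> // f /tI[].
  have [u [uI uJ]] := gens N.+1; exists (u ++ t); split=> [f|d].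
    by rewrite mem_cat => /orP[/uI[]|/tI].
  rewrite leq_eqVlt => /predU1P[->|/tJ[v [vt vs vJ]]].
    by exists u; split=> // f fu; [rewrite mem_cat fu | case: (uI f fu)].
  by exists v; split=> // f /vt ft; rewrite mem_cat ft orbT.
exists t => // J idJ Jt; have [J0 JD JM] := idJ.
move=> f; have [k] := ubnP (size f); elim: k f => // k IHk f sf If.
have [->//|nf] := eqVneq f 0.
pose d := (size f).-1; pose e := minn d N.
have sfd : size f = d.+1 by rewrite prednK // lt0n size_poly_eq0.
have [u [ut us uJ]] := tJ e (geq_minr _ _).
(* Applied to the coefficient ideals of the intersection of [I] and [J], the generation properties
   yield an [h] in both with the same coefficient as [f] in degree [d]. *)
pose IJ g := I g /\ J g.
have idIJ : is_ideal IJ.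
  by split=> [//|x y [? ?] [? ?]|a x [? ?]]; split; auto.
have idC := coef_ideal_ideal d idIJ.
have IeJ : forall a, coef_ideal I e a -> coef_ideal IJ d a.
  apply: uJ => // g gu; apply: coef_idealS (geq_minl d N) _ => //.
  by exists g; split; [split; [apply/tI/ut|apply/Jt/ut] | apply: us |].
have [h [[Ih Jh] sh hd]] : coef_ideal IJ d f`_d.
  case: (leqP d N) => [dN|Nd].
    by apply: IeJ; rewrite /e (minn_idPl dN); exists f; rewrite sfd.
  have eN : e = N by rewrite /e; apply/minn_idPr/ltnW.
  apply: (sJ _ idC) => [a /sN|]; first by rewrite -eN; apply: IeJ.
  by exists d, f; rewrite sfd.
have -> : f = (f - h) + h by rewrite subrK.
have INh x : I (x - h) <-> I x.
  by split=> Ix; [rewrite -[x](subrK h)|rewrite -mulN1r]; apply: ID => //; apply: IM.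
apply: JD => //; apply: IHk; last exact/INh.
apply: (@leq_ltn_trans d); last by rewrite -ltnS -sfd.
apply/leq_sizeP => i di; rewrite coefB.
move: di; rewrite leq_eqVlt => /predU1P[<-|di]; first by rewrite hd subrr.
by rewrite !nth_default ?subrr // ?sfd // (leq_trans sh).
Qed.
End HilbertBasis.

(** * Adding one variable *)

Section LastVariable.
Variables (K : fieldType) (n : nat).

(** The outer variable becomes the last of the [n.+1] variables; inductions on [n] go through this
    surjection. *)
Definition adjoin_last (P : {poly {mpoly K[n]}}) : {mpoly K[n.+1]} :=
  (map_poly (@mwiden n K) P).['X_ord_max].

Fact adjoin_last_zmod_morphism : zmod_morphism adjoin_last.
Proof. by move=> P Q; rewrite /adjoin_last rmorphB !hornerE. Qed.

Fact adjoin_last_monoid_morphism : monoid_morphism adjoin_last.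
Proof.
by split=> [|P Q]; rewrite /adjoin_last ?rmorph1 ?rmorphM ?hornerE.
Qed.

HB.instance Definition _ := GRing.isZmodMorphism.Build
  {poly {mpoly K[n]}} {mpoly K[n.+1]} adjoin_last adjoin_last_zmod_morphism.
HB.instance Definition _ := GRing.isMonoidMorphism.Build
  {poly {mpoly K[n]}} {mpoly K[n.+1]} adjoin_last adjoin_last_monoid_morphism.
End LastVariable.

Lemma mpoly_closed_ind (R : comNzRingType) n (P : {mpoly R[n]} -> Prop) :
  (forall c, P c%:MP) -> (forall i, P 'X_i) ->
  (forall p q, P p -> P q -> P (p + q)) ->
  (forall p q, P p -> P q -> P (p * q)) -> forall p, P p.
Proof.
move=> PC PX PD PM; elim/mpolyind => [|c m p _ _ Pp]; first by rewrite -mpolyC0.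
apply: PD => //; rewrite -mul_mpolyC; apply: (PM) => //.
rewrite mpolyXE_id; apply: (big_ind P) => [||i _]; first by rewrite -mpolyC1.
  by move=> x y; apply: PM.
elim: (m i) => [|k IHk]; first by rewrite expr0 -mpolyC1.
by rewrite exprS; apply: PM.
Qed.

Lemma adjoin_last_surj (K : fieldType) n (f : {mpoly K[n.+1]}) :
  exists P, adjoin_last P = f.
Proof.
elim/mpoly_closed_ind: f => [c|i|_ _ [P <-] [Q <-]|_ _ [P <-] [Q <-]].
- by exists (c%:MP)%:P; rewrite /adjoin_last map_polyC hornerC /= mwidenC.
- case: (unliftP ord_max i) => [k ->|->].
    exists ('X_k)%:P; rewrite /adjoin_last map_polyC hornerC /= mwidenX mnmwiden1.
    by congr 'X_[U_(_)]; apply/val_inj; rewrite /= /bump leqNgt ltn_ord.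
  by exists 'X; rewrite /adjoin_last map_polyX hornerX.
- by exists (P + Q); rewrite rmorphD.
- by exists (P * Q); rewrite rmorphM.
Qed.

Lemma noetherian_mpoly (K : fieldType) n : noetherian {mpoly K[n]}.
Proof.
elim: n => [|n IHn].
  apply: (@noetherian_surj _ _ (@mpolyC 0 K)); last exact: noetherian_field.
  elim/mpoly_closed_ind => [c|[]//|_ _ [x <-] [y <-]|_ _ [x <-] [y <-]].
  - by exists c.
  - by exists (x + y); rewrite rmorphD.
  - by exists (x * y); rewrite rmorphM.
pose h : {rmorphism {poly {mpoly K[n]}} -> {mpoly K[n.+1]}} := @adjoin_last K n.
have noP : noetherian {poly {mpoly K[n]}} := noetherian_poly IHn.
exact: (noetherian_surj (h := h) (@adjoin_last_surj K n) noP).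
Qed.

(** * Specializations into an algebraically closed field *)

Section Specialization.
Variables (R : comNzRingType) (L : fieldType) (ev : {rmorphism R -> L}).
Variable t : L.
Local Notation E := (map_poly ev).

Lemma size_map_poly_rmorph (g : {poly R}) : (size (E g) <= size g)%N.
Proof. exact: size_poly. Qed.

Lemma truncate_kernel (g : {poly R}) :
  exists2 g', E g' = E g & size g' = size (E g).
Proof.
have eqE : E (\poly_(i < size (E g)) g`_i) = E g.
  apply/polyP => i; rewrite !coef_map /= coef_poly.
  by case: ltnP => // lei; rewrite rmorph0 -coef_map nth_default.
exists (\poly_(i < size (E g)) g`_i) => //.
apply/eqP; rewrite eqn_leq size_poly /=.
by have := size_map_poly_rmorph (\poly_(i < size (E g)) g`_i); rewrite eqE.
Qed.

(** [R] is only a ring, so division costs a factor [c], a power of the leading coefficient of [d].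
    The hypothesis on sizes keeps it nonzero under [ev]. *)
Lemma pseudo_division (d g : {poly R}) : E d != 0 -> size (E d) = size d ->
  exists c q r, [/\ ev c != 0, E c%:P * E g = E q * E d + E r &
    (size r < size d)%N].
Proof.
move=> nd sd; pose c := lead_coef d ^+ Pdiv.Ring.rscalp g d.
exists c, (Pdiv.Ring.rdivp g d), (Pdiv.Ring.rmodp g d); split.
- rewrite rmorphXn expf_neq0 //.
  by rewrite lead_coefE -sd -coef_map -lead_coefE lead_coef_eq0.
- by rewrite -!rmorphM -rmorphD /= mul_polyC Pdiv.ComRing.rdivp_eq.
- by rewrite Pdiv.Ring.ltn_rmodpN0 // -size_poly_eq0 -sd size_poly_eq0.
Qed.

Section Algebraic.
Variable m : {poly R}.
Hypotheses (nm : E m != 0) (mt : (E m).[t] = 0) (sm : size (E m) = size m).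
Hypothesis min_m : forall g, (E g).[t] = 0 -> E g != 0 ->
  (size m <= size (E g))%N.

Lemma min_small_eq0 (g : {poly R}) : (E g).[t] = 0 -> (size g < size m)%N -> E g = 0.
Proof.
move=> gt sg; apply/eqP/negPn/negP => /(min_m gt).
by rewrite leqNgt (leq_ltn_trans (size_map_poly_rmorph g)).
Qed.

(** A Euclidean descent, with [m] as minimal polynomial of [t]: dividing [m] by [h] leaves a shorter
    remainder, whose value at [t] is that of [h] times a nonzero factor; it ends at a constant. *)
Lemma algebraic_inverse_small k (h : {poly R}) : (size h < k)%N -> (size h < size m)%N ->
  (E h).[t] != 0 -> exists p r, ev r != 0 /\ (E p).[t] * (E h).[t] = ev r.
Proof.
elim: k h => // k IHk h shk shm ht.
have [h' Eh sh'] := truncate_kernel h; rewrite -Eh in ht sh' *.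
have sh'h : (size h' <= size h)%N by rewrite sh' Eh size_map_poly_rmorph.
have nh' : E h' != 0 by apply: contraNneq ht => ->; rewrite horner0.
case: (leqP (size h') 1) => [/size1_polyC h'C|sh'1].
  exists 1, h'`_0; rewrite rmorph1 hornerC mul1r.
  by move: ht; rewrite h'C map_polyC /= !hornerC coefC eqxx.
have [c [q [r [nc eqn sr]]]] := pseudo_division m nh' (esym sh').
have eqt : (E r).[t] = - ((E q).[t] * (E h').[t]).
  move/(congr1 (fun P => P.[t])): eqn; rewrite !hornerE mt mulr0 => /eqP.
  by rewrite eq_sym addrC addr_eq0 => /eqP.
have srm : (size (E r) < size (E m))%N.
  rewrite sm; apply: leq_ltn_trans (size_map_poly_rmorph _) _.
  by apply: ltn_trans sr _; apply: leq_ltn_trans shm.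
have scm : size (E q * E h') = size m.
  have -> : E q * E h' = ev c *: E m - E r.
    by rewrite -mul_polyC -map_polyC eqn addrK.
  by rewrite size_polyDl ?size_polyN size_scale // sm.
have nq : E q != 0.
  apply: contraNneq nm => q0; rewrite -size_poly_eq0 sm -scm q0.
  by rewrite mul0r size_poly0.
(* By minimality of [m]: [E q] is nonzero and shorter than [m], since [h'] is not constant. *)
have qt : (E q).[t] != 0.
  apply/negP => /eqP /min_m /(_ nq); rewrite -scm size_mul // -sh' leqNgt.
  by case: (size h') sh'1 => [|[|j]] // _; rewrite !addnS /= ltnS leq_addr.
have [||| p [r0 [nr0 pr]]] := IHk r.
- by apply: leq_trans sr _; apply: leq_trans sh'h _; rewrite -ltnS.
- by apply: ltn_trans sr _; apply: leq_ltn_trans shm.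
- by rewrite eqt oppr_eq0 mulf_neq0.
exists (- (p * q)), r0; split=> //.
by rewrite -pr eqt rmorphN rmorphM hornerN hornerM; ring.
Qed.

Lemma algebraic_inverse (h : {poly R}) : (E h).[t] != 0 ->
  exists p r, ev r != 0 /\ (E p).[t] * (E h).[t] = ev r.
Proof.
move=> ht; have [c [q [r [nc eqn sr]]]] := pseudo_division h nm sm.
have eqt : (E r).[t] = ev c * (E h).[t].
  move/(congr1 (fun P => P.[t])): eqn.
  by rewrite map_polyC !hornerE mt mulr0 add0r.
have [|p [r0 [nr0 pr]]] := algebraic_inverse_small (ltnSn _) sr.
  by rewrite eqt mulf_neq0.
exists (p * c%:P), r0; split=> //.
by rewrite -pr eqt rmorphM /= map_polyC hornerM hornerC mulrA.
Qed.
End Algebraic.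

(** If [t] is transcendental, any non-root of the image of [h] can be [xi]; if it is algebraic, a
    root of the image of its minimal polynomial. The element [r] is chosen before [phi], so that it
    can be the polynomial to keep nonzero at the preceding coordinates. *)
Lemma specialization_step (Omega : closedFieldType) (h : {poly R}) :
  (E h).[t] != 0 ->
  exists2 r, ev r != 0 & forall phi : {rmorphism R -> Omega},
    (forall a, ev a = 0 -> phi a = 0) -> phi r != 0 ->
    exists2 xi, forall g, (E g).[t] = 0 -> (map_poly phi g).[xi] = 0 &
      (map_poly phi h).[xi] != 0.
Proof.
move=> ht.
have kerE (phi : {rmorphism R -> Omega}) g :
    (forall a, ev a = 0 -> phi a = 0) -> E g = 0 -> map_poly phi g = 0.
  move=> ker g0; apply/polyP => i; rewrite coef_map coef0; apply: ker.
  by rewrite -coef_map g0 coef0.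
pose A k := `[< exists m, [/\ (E m).[t] = 0, E m != 0 & size (E m) = k] >].
have [[k Ak]|noA] := pselect (exists k, A k); last first.
  (* Transcendental case: this coefficient lifts the leading coefficient of [E h], and [h] stays
     nonzero under any [phi] that does not kill it. *)
  exists h`_(size (E h)).-1.
    rewrite -coef_map -lead_coefE lead_coef_eq0.
    by apply: contraNneq ht => ->; rewrite horner0.
  move=> phi ker; rewrite -coef_map => nphi.
  have /closed_nonrootP[xi xiP] : map_poly phi h != 0.
    by apply: contraNneq nphi => ->; rewrite coef0.
  exists xi => // g gt; rewrite (kerE phi) ?horner0 //.
  apply/eqP/negPn/negP => ng; apply: noA.
  by exists (size (E g)); apply/asboolP; exists g.
have exA : exists k, A k by exists k.
case: (ex_minnP exA) => {Ak}k /asboolP[m0 [m0t nm0 sm0]] min_k.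
have [m Em sm] := truncate_kernel m0; rewrite -Em in m0t nm0 sm0 sm.
have min_m g : (E g).[t] = 0 -> E g != 0 -> (size m <= size (E g))%N.
  by move=> gt ng; rewrite sm sm0; apply: min_k; apply/asboolP; exists g.
have [p [r [nr pr]]] := algebraic_inverse nm0 m0t (esym sm) min_m ht.
(* The first factor keeps the degree of [m] under [phi], so that a root [xi] exists and the factor
   from pseudo-division can be cancelled. The second forbids [h] to vanish at [xi], where [p * h]
   takes the value [phi r]. *)
exists (lead_coef m * r).
  rewrite rmorphM mulf_neq0 // lead_coefE sm -coef_map -lead_coefE.
  by rewrite lead_coef_eq0.
move=> phi ker; rewrite rmorphM mulf_eq0 negb_or => /andP[nphil nphir].
have /closed_rootP[xi /rootP xiP] : size (map_poly phi m) != 1%N.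
  rewrite size_map_poly_id0 // sm; apply/negP => /size_poly1P[a na Ema].
  by move: m0t; rewrite Ema hornerC => /eqP; rewrite (negPf na).
have zeros g : (E g).[t] = 0 -> (map_poly phi g).[xi] = 0.
  move=> gt; pose c := lead_coef m ^+ Pdiv.Ring.rscalp g m.
  have eqn : c%:P * g = Pdiv.Ring.rdivp g m * m + Pdiv.Ring.rmodp g m.
    by rewrite mul_polyC Pdiv.ComRing.rdivp_eq.
  have Er0 : E (Pdiv.Ring.rmodp g m) = 0.
    apply: (min_small_eq0 min_m).
      move/(congr1 (fun P => (E P).[t])): eqn.
      by rewrite !rmorphD !rmorphM !hornerE gt m0t !mulr0 add0r.
    by rewrite Pdiv.Ring.ltn_rmodpN0 // -size_poly_eq0 sm size_poly_eq0.
  move/(congr1 (fun P => (map_poly phi P).[xi])): eqn.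
  rewrite !rmorphD !rmorphM /= !hornerE xiP (kerE phi _ ker Er0) map_polyC !hornerE.
  move/eqP; rewrite mulf_eq0 /= rmorphXn expf_eq0 (negPf nphil) andbF.
  by move/eqP.
exists xi => //; apply: contraNneq nphir => hxi.
have := zeros (p * h - r%:P); rewrite !rmorphB !rmorphM /= !map_polyC !hornerE /= pr.
by rewrite hxi mulr0 subrr => /(_ erefl)/eqP; rewrite sub0r oppr_eq0.
Qed.
End Specialization.

Lemma mmap_adjoin_last (K S : fieldType) (h : {rmorphism K -> S}) n
    (z : 'I_n.+1 -> S) (P : {poly {mpoly K[n]}}) :
  mmap h z (adjoin_last P) =
  (map_poly (mmap h (fun i => z (lift ord_max i))) P).[z ord_max].
Proof.
elim/poly_ind: P => [|P c IHP]; first by rewrite !rmorph0 horner0.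
rewrite !rmorphD !rmorphM !hornerE /= IHP.
rewrite /adjoin_last map_polyX map_polyC !hornerE !map_polyC !hornerE.
rewrite map_polyX !hornerE /=.
rewrite mmapX mmap1U; congr (_ + _).
elim/mpoly_closed_ind: c => [c|i|p q IHp IHq|p q IHp IHq].
- by rewrite mwidenC !mmapC.
- rewrite mwidenX mnmwiden1 !mmapX !mmap1U; congr z; apply/val_inj.
  by rewrite /= /bump leqNgt ltn_ord.
- by rewrite !rmorphD /= IHp IHq.
- by rewrite !rmorphM /= IHp IHq.
Qed.

(** A form of the Nullstellensatz: some [K]-algebra map from [K[c]] to [Omega] does not kill [f(c)].
    In the induction, the [r] of the one-coordinate step is the polynomial to keep nonzero at the
    other coordinates. *)
Lemma specialization (K L : fieldType) (Omega : closedFieldType)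
    (j : {rmorphism K -> L}) (iota : {rmorphism K -> Omega}) n (c : 'I_n -> L)
    (f : {mpoly K[n]}) : mmap j c f != 0 ->
  exists2 z : 'I_n -> Omega,
    forall g, mmap j c g = 0 -> mmap iota z g = 0 & mmap iota z f != 0.
Proof.
elim: n c f => [|n IHn] c f.
  have consts (g : {mpoly K[0]}) : exists a, g = a%:MP.
    elim/mpoly_closed_ind: g => [a|[]//|_ _ [a ->] [b ->]|_ _ [a ->] [b ->]].
    - by exists a.
    - by exists (a + b); rewrite rmorphD.
    - by exists (a * b); rewrite rmorphM.
  have [a ->] := consts f; rewrite mmapC fmorph_eq0 => na.
  exists (fun=> 0) => [g|]; last by rewrite mmapC fmorph_eq0.
  have [b ->] := consts g; rewrite !mmapC => /eqP.
  by rewrite fmorph_eq0 => /eqP->; exact: rmorph0.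
have [P <-] := adjoin_last_surj f; rewrite mmap_adjoin_last => ft.
have [r nr rP] := specialization_step Omega ft.
have [z zker nzr] := IHn _ _ nr.
have [xi xiP nxi] := rP (mmap iota z) zker nzr.
pose z' i := if unlift ord_max i is Some k then z k else xi.
have z'E Q : mmap iota z' (adjoin_last Q) = (map_poly (mmap iota z) Q).[xi].
  rewrite mmap_adjoin_last /z' unlift_none; congr (map_poly (mmap _ _) _).[_].
  by apply/funext => i; rewrite liftK.
exists z' => [g|]; last by rewrite z'E.
by have [Q <-] := adjoin_last_surj g; rewrite mmap_adjoin_last z'E; apply: xiP.
Qed.

(** * Extending derivations to separable extensions *)

(* A derivation into L defined on a subring of L, given by its graph. *)
Definition partial_derivation (L : fieldType) (G : L -> L -> Prop) : Prop :=
  [/\ G 1 0, forall x y dx dy, G x dx -> G y dy -> G (x - y) (dx - dy),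
      forall x y dx dy, G x dx -> G y dy -> G (x * y) (dx * y + x * dy) &
      forall d, G 0 d -> d = 0].

Section ExtendToElement.
Variables (L : fieldType) (G : L -> L -> Prop).
Hypothesis pG : partial_derivation G.

Lemma pder0 : G 0 0.
Proof. by have [G1 GB _ _] := pG; have := GB _ _ _ _ G1 G1; rewrite !subrr. Qed.

Lemma pderD x y dx dy : G x dx -> G y dy -> G (x + y) (dx + dy).
Proof.
move=> Gx Gy; have [_ GB _ _] := pG.
have := GB _ _ _ _ Gx (GB _ _ _ _ pder0 Gy); by rewrite !sub0r !opprK.
Qed.

Lemma pder_fun x d1 d2 : G x d1 -> G x d2 -> d1 = d2.
Proof.
move=> G1 G2; have [_ GB _ G0] := pG; apply/eqP; rewrite -subr_eq0.
by apply/eqP/G0; have := GB _ _ _ _ G1 G2; rewrite subrr.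
Qed.

Lemma pder_sum (I : finType) (F F' : I -> L) :
  (forall i, G (F i) (F' i)) -> G (\sum_i F i) (\sum_i F' i).
Proof.
move=> GF; apply: (big_ind2 G) => [|x dx y dy|i _]; first exact: pder0.
  exact: pderD.
exact: GF.
Qed.

(** [g] is [f] with its coefficients differentiated; a relation, since [G] is one. *)
Definition polyG (f g : {poly L}) := forall i, G f`_i g`_i.

Lemma polyGC a da : G a da -> polyG a%:P da%:P.
Proof. by move=> Ga i; rewrite !coefC; case: ifP => // _; apply: pder0. Qed.

Lemma polyGXn k : polyG 'X^k 0.
Proof.
have [G1 _ _ _] := pG.
by move=> i; rewrite coefXn coef0; case: eqP => _ //; apply: pder0.
Qed.

Lemma polyGB f1 g1 f2 g2 : polyG f1 g1 -> polyG f2 g2 ->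
  polyG (f1 - f2) (g1 - g2).
Proof. by have [_ GB _ _] := pG; move=> G1 G2 i; rewrite !coefB; apply: GB. Qed.

Lemma polyGM f1 g1 f2 g2 : polyG f1 g1 -> polyG f2 g2 ->
  polyG (f1 * f2) (g1 * f2 + f1 * g2).
Proof.
have [_ _ GM _] := pG; move=> G1 G2 i; rewrite coefD !coefM -big_split /=.
by apply: pder_sum => k; apply: GM.
Qed.

Lemma polyG_deriv f g : polyG f g -> polyG f^`() g^`().
Proof.
move=> Gfg i; rewrite !coef_deriv -[f`__ *+ _]mulr_natr -[g`__ *+ _]mulr_natr.
have GN k : G k%:R 0.
  elim: k => [|k IHk]; first exact: pder0.
  by rewrite -addn1 natrD -[0]addr0; apply: pderD => //; have [] := pG.
have [_ _ GM _] := pG.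
by have := GM _ _ _ _ (Gfg i.+1) (GN i.+1); rewrite mulr0 addr0.
Qed.

Lemma polyG0 g : polyG 0 g -> g = 0.
Proof.
have [_ _ _ G0] := pG.
by move=> Gg; apply/polyP => i; rewrite coef0; apply: G0; have := Gg i; rewrite coef0.
Qed.

Variable t : L.

(** The derivative of [f.[t]] by the chain rule, when [t] has derivative [u] and [g] is [f] with
    differentiated coefficients. *)
Definition value u (f g : {poly L}) := g.[t] + f^`().[t] * u.

Lemma valueM u f1 g1 f2 g2 : value u (f1 * f2) (g1 * f2 + f1 * g2) =
  value u f1 g1 * f2.[t] + f1.[t] * value u f2 g2.
Proof. by rewrite /value derivM !hornerE; ring. Qed.

Lemma valueB u f1 g1 f2 g2 :
  value u (f1 - f2) (g1 - g2) = value u f1 g1 - value u f2 g2.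
Proof. by rewrite /value derivB !hornerE; ring. Qed.

(* Reducing modulo a polynomial of minimal degree killing t. *)
Lemma value_minimal u m gm : polyG m gm -> m != 0 -> m.[t] = 0 ->
    (forall f g, polyG f g -> f.[t] = 0 -> f != 0 -> (size m <= size f)%N) ->
    value u m gm = 0 ->
  forall f g, polyG f g -> f.[t] = 0 -> value u f g = 0.
Proof.
move=> Gm nm mt min_m vm f g; have [k] := ubnP (size f).
elim: k f g => // k IHk f g sf Gf ft.
have [f0|nf] := eqVneq f 0.
  move: Gf; rewrite f0 => /polyG0 ->.
  by rewrite /value deriv0 !horner0 mul0r addr0.
have smf := min_m _ _ Gf ft nf.
pose e := (size f - size m)%N.
pose b := lead_coef m; pose a := lead_coef f.
have [db Gb] : exists db, G b db by exists gm`_(size m).-1; apply: Gm.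
have [da Ga] : exists da, G a da by exists g`_(size f).-1; apply: Gf.
(* [b * f - q * m] has lower degree than [f] and vanishes at [t]. Its [value] is [b] times that of
   [f], because [m.[t]], [f.[t]] and the [value] of [m] are 0. *)
pose q := a%:P * 'X^e.
have Gq : polyG q (da%:P * 'X^e + a%:P * 0) := polyGM (polyGC Ga) (polyGXn e).
have Gbf := polyGM (polyGC Gb) Gf; have Gqm := polyGM Gq Gm.
have nb : b != 0 by rewrite lead_coef_eq0.
have := IHk _ _ _ (polyGB Gbf Gqm).
rewrite valueB valueM [value u (q * m) _]valueM vm mt ft !mulr0 add0r addr0 subr0.
rewrite hornerD hornerN !hornerM hornerC ft mt !mulr0 subr0.
have sfS : size f = (size f).-1.+1 by rewrite prednK // lt0n size_poly_eq0.
move=> IH; have : b * value u f g = 0.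
  apply: IH => //; apply: leq_trans (_ : (size f).-1.+1 <= k)%N; last first.
    by rewrite -sfS -ltnS.
  rewrite ltnS; apply/leq_sizeP => i; rewrite leq_eqVlt => /predU1P[<-|lei].
    rewrite coefB coefCM /q -mulrA coefCM coefXnM.
    have sm0 : (0 < size m)%N by rewrite lt0n size_poly_eq0.
    have -> : ((size f).-1 < e)%N = false.
      by apply/negbTE; rewrite -leqNgt /e -ltnS -sfS ltn_subrL sm0 (leq_trans sm0).
    have -> : ((size f).-1 - e = (size m).-1)%N.
      by rewrite /e -!subn1 subnAC subKn.
    by rewrite -!lead_coefE mulrC subrr.
  apply: nth_default; apply: leq_trans (size_polyD _ _) _; rewrite size_polyN.
  have lei' : (size f <= i)%N by rewrite sfS.
  rewrite geq_max; apply/andP; split; apply: leq_trans lei'.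
    by rewrite mul_polyC size_scale.
  rewrite /q -mulrA mul_polyC; apply: leq_trans (size_scale_leq _ _) _.
  apply: leq_trans (size_polyMleq _ _) _; rewrite size_polyXn /=.
  by rewrite /e subnK.
by move/eqP; rewrite mulf_eq0 (negPf nb) => /eqP.
Qed.

Hypothesis Gpow : forall p, p \in [pchar L] -> forall c, G (c ^+ p) 0.

(** If [t] is transcendental over the domain of [G], [u = 0] works. Otherwise take a relation [m] of
    minimal degree. If its formal derivative is nonzero at [t], then [u] solves a linear equation.
    If not, that derivative is zero by minimality, and [m] is a constant times [X^p - t^p], whose
    coefficients have derivative 0 by [Gpow]; again [u = 0] works. *)
Lemma exists_value : exists u, forall f g, polyG f g -> f.[t] = 0 ->
  value u f g = 0.
Proof.
pose A k := `[< exists m gm, [/\ polyG m gm, m.[t] = 0, m != 0 & size m = k] >].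
have [exA|noA] := pselect (exists k, A k); last first.
  exists 0 => f g Gf ft; have f0 : f = 0.
    apply/eqP/negPn/negP => nf; apply: noA; exists (size f).
    by apply/asboolP; exists f, g.
  move: Gf; rewrite f0 => /polyG0 ->.
  by rewrite /value deriv0 !horner0 mul0r addr0.
case: (ex_minnP exA) => k /asboolP[m [gm [Gm mt nm sm]]] min_k.
have min_m f g : polyG f g -> f.[t] = 0 -> f != 0 -> (size m <= size f)%N.
  by move=> Gf ft nf; rewrite sm; apply: min_k; apply/asboolP; exists f, g.
have [m't|nm't] := eqVneq m^`().[t] 0; last first.
  exists (- gm.[t] / m^`().[t]); apply: (value_minimal Gm nm mt min_m _).
  by rewrite /value mulrC divfK // subrr.
exists 0; apply: (value_minimal Gm nm mt min_m _).
rewrite /value mulr0 addr0.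
have m'0 : m^`() = 0.
  apply/eqP/negPn/negP => /(min_m _ _ (polyG_deriv Gm) m't).
  by rewrite leqNgt lt_size_deriv.
have [d sd] : exists d, size m = d.+2.
  case sm': (size m) => [|[|d]]; last by exists d.
    by move/eqP: sm'; rewrite size_poly_eq0 (negPf nm).
  move/eqP/size_poly1P: sm' => [c nc mc].
  by move/eqP: mt; rewrite mc hornerC (negPf nc).
have md : m`_d.+1 != 0.
  by move: nm; rewrite -lead_coef_eq0 lead_coefE sd.
have d0 : d.+1%:R = 0 :> L.
  apply/eqP; have := coef_deriv m d; rewrite m'0 coef0.
  rewrite -[m`__ *+ _]mulr_natr => /esym/eqP.
  by rewrite mulf_eq0 (negPf md).
have [p pL] : exists p, p \in [pchar L] by apply: (natf0_pchar (ltn0Sn d)); apply/eqP.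
have p_gt0 := prime_gt0 (pcharf_prime pL).
(* The degree [d.+1] of [m] is a multiple of [p]. It is also at most [p], since [w] below vanishes
   at [t] and has coefficients in the domain of [G]. *)
have pd : (p <= d.+1)%N by apply: dvdn_leq => //; rewrite (dvdn_pcharf pL) d0.
pose w := 'X^p - (t ^+ p)%:P.
have Gw : polyG w (0 - 0%:P).
  by apply: polyGB; [apply: polyGXn | apply/polyGC/Gpow].
have wt : w.[t] = 0 by rewrite /w !hornerE subrr.
have sw : size w = p.+1 by rewrite size_XnsubC.
have smp : size m = p.+1.
  apply/eqP; rewrite eqn_leq [in X in _ && X]sd [X in _ && X]pd andbT -sw.
  by apply: (min_m _ _ Gw wt); rewrite -size_poly_eq0 sw.
pose b := lead_coef m.
have Gb : G b gm`_(size m).-1 by apply: Gm.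
have Gbw := polyGM (polyGC Gb) Gw.
have := polyGB Gm Gbw; set f := (X in polyG X); set g := (X in polyG _ X) => Gf.
have f0 : f = 0.
  apply/eqP/negPn/negP => nf; have := min_m _ _ Gf.
  rewrite /f hornerD hornerN hornerM wt mt mulr0 subrr => /(_ erefl nf); rewrite leqNgt.
  suff -> : (size f < size m)%N by [].
  rewrite smp ltnS; apply/leq_sizeP => i; rewrite leq_eqVlt => /predU1P[<-|lei].
    rewrite /f coefB coefCM /w coefB coefXn eqxx coefC.
    rewrite (gtn_eqF p_gt0) subr0 mulr1.
    by rewrite /b lead_coefE smp subrr.
  rewrite /f coefB coefCM nth_default ?smp // [w`_i]nth_default ?sw //.
  by rewrite mulr0 subrr.
move: Gf; rewrite f0 => /polyG0; rewrite /g => /eqP; rewrite subr_eq0 => /eqP ->.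
by rewrite hornerD !hornerM wt mulr0 add0r subrr horner0 mulr0.
Qed.

(** [G'] lives on the ring generated by [t] over the domain of [G]; the choice of [u] makes it
    single-valued. *)
Lemma extend_to_element : exists G', [/\ partial_derivation G',
  forall x d, G x d -> G' x d & exists u, G' t u].
Proof.
have [u uP] := exists_value.
exists (fun x d => exists f g, [/\ polyG f g, f.[t] = x & value u f g = d]).
have incl x d : G x d ->
    exists f g, [/\ polyG f g, f.[t] = x & value u f g = d].
  move=> Gx; exists x%:P, d%:P; split; rewrite ?hornerC //; first exact: polyGC.
  by rewrite /value derivC hornerC horner0 mul0r addr0.
split=> //; last first.
  exists u, 'X, 0; split; rewrite ?hornerX //; first exact: (polyGXn 1).
  by rewrite /value derivX !hornerE.
split.
- by apply: incl; have [] := pG.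
- move=> _ _ _ _ [f1 [g1 [G1 <- <-]]] [f2 [g2 [G2 <- <-]]].
  by exists (f1 - f2), (g1 - g2); rewrite valueB !hornerE; split=> //; apply: polyGB.
- move=> _ _ _ _ [f1 [g1 [G1 <- <-]]] [f2 [g2 [G2 <- <-]]].
  exists (f1 * f2), (g1 * f2 + f1 * g2).
  by rewrite valueM hornerM; split=> //; apply: polyGM.
- by move=> _ [f [g [Gf ft <-]]]; apply: uP.
Qed.
End ExtendToElement.

Lemma extend_to_field (L : fieldType) (G : L -> L -> Prop) :
  partial_derivation G -> (forall p, p \in [pchar L] -> forall c, G (c ^+ p) 0) ->
  exists2 D : L -> L, derivation D & forall x d, G x d -> D x = d.
Proof.
move=> pG Gpow.
(* Zorn's lemma is applied to the sets of pairs that give a partial derivation when added to [G]; so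
   everything considered extends [G]. *)
pose H (A : classical_sets.set (L * L)) x d := G x d \/ A (x, d).
have [F FP Ftot|A [pA maxA]] :=
    @classical_sets.Zorn_bigcup (L * L)%type (fun A => partial_derivation (H A)).
  (* The empty set joins the chain so that an empty [F] is covered too, with union [G]. *)
  pose F' A := F A \/ A = classical_sets.set0.
  pose U := H (classical_sets.bigcup F id).
  have UP x d : U x d <-> exists2 A, F' A & H A x d.
    split=> [[Gx|[A FA Ax]]|[A [FA|->] [Gx|Ax]]].
    - by exists classical_sets.set0; [right | left].
    - by exists A; [left | right].
    - by left.
    - by right; exists A.
    - by left.
    - by case: Ax.
  have F'P A : F' A -> partial_derivation (H A).
    case=> [/FP//|->].
    suff -> : H classical_sets.set0 = G by [].
    apply/funext => x; apply/funext => d; apply/propext.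
    by split=> [[//|[]]|]; left.
  have F'tot x y dx dy : U x dx -> U y dy ->
      exists A, [/\ F' A, H A x dx & H A y dy].
    move=> /UP[A FA Ax] /UP[B FB By].
    have HS (C E : classical_sets.set (L * L)) : classical_sets.subset C E ->
        forall x d, H C x d -> H E x d.
      by move=> CE z d [|/CE]; [left | right].
    have [AB|BA] : classical_sets.subset A B \/ classical_sets.subset B A.
      case: FA FB => [FA|->] [FB|->]; [|by right|by left|by left].
      exact: Ftot.
    - by exists B; split=> //; apply: HS Ax.
    - by exists A; split=> //; apply: HS By.
  have U1 : U 1 0 by have [G1 _ _ _] := pG; left.
  split=> //.
  - move=> x y dx dy Ux Uy; have [A [FA Ax Ay]] := F'tot _ _ _ _ Ux Uy.
    by apply/UP; exists A => //; have [_ + _ _] := F'P A FA; apply.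
  - move=> x y dx dy Ux Uy; have [A [FA Ax Ay]] := F'tot _ _ _ _ Ux Uy.
    by apply/UP; exists A => //; have [_ _ + _] := F'P A FA; apply.
  - by move=> d /UP[A /F'P[_ _ _ A0] /A0].
have tot x : exists d, H A x d.
  have [|G' [pG' GG' [u G'u]]] := extend_to_element pA x.
    by move=> p pL c; left; apply: Gpow.
  pose B (z : L * L) := G' z.1 z.2.
  have HB : H B = G'.
    apply/funext => y; apply/funext => d; apply/propext.
    by split=> [[Gy|//]|]; [apply: GG'; left | right].
  apply: contrapT => nx; apply: (maxA B); last by rewrite HB.
  split=> [[y d] Ay|BA]; first by apply: GG'; right.
  by apply: nx; exists u; right; apply: (BA (x, u)).
pose D x := sval (cid (tot x)).
have DP x : H A x (D x) by rewrite /D; case: cid.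
have DE x d : H A x d -> D x = d by apply: (pder_fun pA).
exists D => [|x d Gx]; last by apply: DE; left.
have [_ _ HM _] := pA.
by split=> [x y|x y]; apply: DE; [apply: (pderD pA) | apply: HM].
Qed.

Lemma pder_pow (L : fieldType) (G : L -> L -> Prop) p x d :
  partial_derivation G -> p \in [pchar L] -> G x d -> G (x ^+ p) 0.
Proof.
move=> pG pL Gx; have [G1 _ GM _] := pG.
have GX k : G (x ^+ k) (d * x ^+ k.-1 *+ k).
  elim: k => [|k IHk]; first by rewrite expr0 mulr0n.
  have := GM _ _ _ _ Gx IHk; rewrite -exprS.
  congr (G _ _); case: k {IHk} => [|k] /=; first by rewrite mulr0n mulr0 addr0 mulr1n.
  by rewrite mulrnAr mulrCA -exprS [in RHS]mulrS.
by have := GX p; rewrite -[_ *+ p]mulr_natr (pcharf0 pL) mulr0.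
Qed.

(** * Separability as linear disjointness from [p]-th powers *)

Section SeparableExtension.
Variables (L : fieldType) (G : L -> L -> Prop).
Hypothesis pG : partial_derivation G.
Hypothesis sepG : separable_over (fun x => exists d, G x d).

(** Induction on the number of terms. If [b] is independent over the [p]-th powers of the domain of
    [G], separability makes every [c i ^+ p] zero. Otherwise there is a relation [a] over these
    powers; they have derivative 0, so differentiating shows that [a] is also a relation of [db],
    and it serves to eliminate one term. *)
Lemma separable_relation_ord p m (b db c : 'I_m -> L) : p \in [pchar L] ->
  (forall i, G (b i) (db i)) ->
  \sum_i c i ^+ p * b i = 0 -> \sum_i c i ^+ p * db i = 0.
Proof.
move=> pL; elim: m b db c => [|m IHm] b db c Gb cb; first by rewrite big_ord0.
have frobB (x y : L) : (x - y) ^+ p = x ^+ p - y ^+ p.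
  by rewrite -!(pFrobenius_autE pL) rmorphB.
set indep := lin_indep (fun c => exists2 d, exists e, G d e & c = d ^+ p) b.
have [ind|] := pselect indep.
  apply: big1 => i _; suff -> : c i ^+ p = 0 by rewrite mul0r.
  have indL : lin_indep (fun c => exists d, c = d ^+ p) b.
    by apply: (sepG pL) ind => k; exists (db k).
  exact: (indL (fun i => c i ^+ p) (fun k => ex_intro _ (c k) erefl) cb i).
move=> /existsNP[a] /not_implyP[aG] /not_implyP[ab] /existsNP[k /eqP ak].
have adb : \sum_i a i * db i = 0.
  have [_ _ GM G0] := pG; apply: G0.
  suff : G (\sum_i a i * b i) (\sum_i a i * db i) by rewrite ab.
  apply: (pder_sum pG) => i; have [d [e Gd] ->] := aG i.
  by have := GM _ _ _ _ (pder_pow pG pL Gd) (Gb i); rewrite mul0r add0r.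
have [d da] : exists d, forall i, a i = d i ^+ p.
  have aG' i : exists d, a i = d ^+ p by have [d _ ->] := aG i; exists d.
  by exists (fun i => sval (cid (aG' i))) => i; case: cid.
have ndk : d k != 0.
  by apply: contraNneq ak => dk; rewrite da dk expr0n -leqn0 leqNgt prime_gt0 //
    (pcharf_prime pL).
(* By additivity of Frobenius, subtracting [w ^+ p] times the relation [a] turns each [c i ^+ p]
   into [e i ^+ p], and [e k] is 0. *)
have [w wd] : exists w, w * d k = c k by exists (c k / d k); rewrite divfK.
pose e i := c i - w * d i.
have ek : e k = 0 by rewrite /e wd subrr.
have eE (v : 'I_m.+1 -> L) : \sum_i a i * v i = 0 ->
    \sum_i c i ^+ p * v i = \sum_i e (lift k i) ^+ p * v (lift k i).
  move=> av; have -> : \sum_i c i ^+ p * v i = \sum_i e i ^+ p * v i.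
    transitivity (\sum_i c i ^+ p * v i - w ^+ p * \sum_i a i * v i).
      by rewrite av mulr0 subr0.
    rewrite mulr_sumr -sumrB.
    by apply: eq_bigr => i _; rewrite /e frobB exprMn da; ring.
  by rewrite (bigD1_ord k) //= ek expr0n -leqn0 leqNgt (prime_gt0 (pcharf_prime pL))
    mul0r add0r.
rewrite eE //; apply: IHm => [i|]; last by rewrite -[LHS](eE b).
exact: Gb.
Qed.

Lemma separable_relation p (I : finType) (b db c : I -> L) : p \in [pchar L] ->
  (forall i, G (b i) (db i)) ->
  \sum_i c i ^+ p * b i = 0 -> \sum_i c i ^+ p * db i = 0.
Proof.
move=> pL Gb.
have reidx (F : I -> L) : \sum_i F i = \sum_(i < #|I|) F (enum_val i).
  by rewrite (reindex _ (onW_bij _ (enum_val_bij _))).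
by rewrite !reidx; apply: separable_relation_ord => // i; apply: Gb.
Qed.

(* The L^p-linear extension of G to the compositum of L^p and its domain. *)
Definition frobenius_span p x d := exists (I : finType) (b db c : I -> L),
  [/\ forall i, G (b i) (db i), x = \sum_i c i ^+ p * b i &
      d = \sum_i c i ^+ p * db i].

Lemma frobenius_span_incl p x d : G x d -> frobenius_span p x d.
Proof.
move=> Gx; exists unit, (fun=> x), (fun=> d), (fun=> 1); split=> //;
by rewrite big_const card_unit /= expr1n mul1r addr0.
Qed.

Lemma frobenius_span_pder p : p \in [pchar L] ->
  partial_derivation (frobenius_span p).
Proof.
move=> pL; have [G1 GB GM _] := pG; split.
- exact: frobenius_span_incl.
- move=> _ _ _ _ [I1 [b1 [db1 [c1 [Gb1 -> ->]]]]] [I2 [b2 [db2 [c2 [Gb2 -> ->]]]]].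
  exists (I1 + I2)%type,
    (fun i => match i with inl i => b1 i | inr i => 0 - b2 i end),
    (fun i => match i with inl i => db1 i | inr i => 0 - db2 i end),
    (fun i => match i with inl i => c1 i | inr i => c2 i end).
  split; first by case=> i //; apply: GB => //; apply: pder0.
    rewrite big_sumType /= -sumrN; congr (_ + _).
    by apply: eq_bigr => i _; rewrite sub0r mulrN.
  rewrite big_sumType /= -sumrN; congr (_ + _).
  by apply: eq_bigr => i _; rewrite sub0r mulrN.
- move=> _ _ _ _ [I1 [b1 [db1 [c1 [Gb1 -> ->]]]]] [I2 [b2 [db2 [c2 [Gb2 -> ->]]]]].
  exists (I1 * I2)%type, (fun i => b1 i.1 * b2 i.2),
    (fun i => db1 i.1 * b2 i.2 + b1 i.1 * db2 i.2), (fun i => c1 i.1 * c2 i.2).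
  split; first by move=> i; apply: GM.
    rewrite big_distrlr pair_bigA /=; apply: eq_bigr => i _.
    by rewrite exprMn; ring.
  rewrite !big_distrlr !pair_bigA -big_split /=; apply: eq_bigr => i _.
  by rewrite exprMn; ring.
- by move=> d [I [b [db [c [Gb /esym cb ->]]]]]; apply: separable_relation Gb cb.
Qed.

(** [extend_to_field] wants [p]-th powers to be constants: vacuous in characteristic 0, and in
    characteristic [p] achieved by passing first to the span over [L^p]. *)
Lemma separable_derivation_extends :
  exists2 D : L -> L, derivation D & forall x d, G x d -> D x = d.
Proof.
have [[p pL]|noL] := pselect (exists p, p \in [pchar L]); last first.
  by apply: extend_to_field => // p pL; case: noL; exists p.
have [q qL c|D derD DE] := extend_to_field (frobenius_span_pder pL).
  rewrite (pcharf_eq pL) inE in qL; move/eqP: qL => ->.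
  exists unit, (fun=> 1), (fun=> 0), (fun=> c); have [G1 _ _ _] := pG.
  by split=> //; rewrite big_const card_unit /= ?mulr1 ?mulr0 addr0.
by exists D => // x d Gx; apply/DE/frobenius_span_incl.
Qed.
End SeparableExtension.

(** The quotient rule with denominators cleared; the third hypothesis lets [D] descend from [R] to
    its image under [ev]. *)
Lemma fraction_pder (R : comNzRingType) (L : fieldType) (ev : {rmorphism R -> L})
    (D : R -> L) :
  (forall a b, D (a - b) = D a - D b) ->
  (forall a b, D (a * b) = D a * ev b + ev a * D b) ->
  (forall a, ev a = 0 -> D a = 0) ->
  partial_derivation (fun x d => exists f g,
    [/\ ev g != 0, x * ev g = ev f & d * ev g + x * D g = D f]).
Proof.
move=> DB DM D0.
have D1 : D 1 = 0.
  have := DM 1 1; rewrite mulr1 rmorph1 mulr1 mul1r => /eqP.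
  by rewrite -subr_eq subrr eq_sym => /eqP.
split.
- by exists 1, 1; rewrite rmorph1 oner_neq0 mulr1 mul0r add0r D1 mulr0.
- move=> x y dx dy [f1 [g1 [n1 x1 d1]]] [f2 [g2 [n2 x2 d2]]].
  exists (f1 * g2 - f2 * g1), (g1 * g2); split.
  + by rewrite rmorphM mulf_neq0.
  + by rewrite rmorphB !rmorphM -x1 -x2; ring.
  + by rewrite DB !DM -d1 -d2 -x1 -x2 rmorphM; ring.
- move=> x y dx dy [f1 [g1 [n1 x1 d1]]] [f2 [g2 [n2 x2 d2]]].
  exists (f1 * f2), (g1 * g2); split.
  + by rewrite rmorphM mulf_neq0.
  + by rewrite !rmorphM -x1 -x2; ring.
  + by rewrite !DM -d1 -d2 -x1 -x2 rmorphM; ring.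
- move=> d [f [g [ng /esym]]]; rewrite mul0r => /D0 ->; rewrite mul0r addr0 => /eqP.
  by rewrite mulf_eq0 (negPf ng) orbF => /eqP.
Qed.

(** * Total derivatives and function fields *)

Section Derivations.
Variables (K : fieldType) (delta : K -> K).
Hypothesis der : derivation delta.

Lemma derivation0 : delta 0 = 0.
Proof. by have [dD _] := der; apply: (addrI (delta 0)); rewrite -dD !addr0. Qed.

Lemma derivationB x y : delta (x - y) = delta x - delta y.
Proof.
have [dD _] := der; apply: (addIr (delta y)).
by rewrite -dD !subrK.
Qed.

Lemma derivation1 : delta 1 = 0.
Proof.
have [_ dM] := der; apply: (addrI (delta 1)); rewrite addr0.
by have := dM 1 1; rewrite !mulr1 mul1r.
Qed.

Variable n : nat.

Lemma mcoeff_map_derivation m (p : {mpoly K[n]}) :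
  (map_mpoly delta p)@_m = delta p@_m.
Proof.
pose dB := GRing.isZmodMorphism.Build K K delta derivationB.
pose d : {additive K -> K} := HB.pack delta dB.
exact: (mcoeff_map_mpoly d).
Qed.

Lemma map_derivationB (p q : {mpoly K[n]}) :
  map_mpoly delta (p - q) = map_mpoly delta p - map_mpoly delta q.
Proof.
by apply/mpolyP => m; rewrite mcoeffB !mcoeff_map_derivation mcoeffB derivationB.
Qed.

Lemma map_derivationM (p q : {mpoly K[n]}) :
  map_mpoly delta (p * q) = map_mpoly delta p * q + p * map_mpoly delta q.
Proof.
have [dD dM] := der.
apply/mpolyP => m; rewrite mcoeffD mcoeff_map_derivation !mcoeffM -big_split /=.
rewrite (big_morph _ dD derivation0); apply: eq_bigr => k _.
by rewrite dM !mcoeff_map_derivation.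
Qed.

Lemma map_derivationC c : map_mpoly delta c%:MP_[n] = (delta c)%:MP.
Proof.
apply/mpolyP => m; rewrite mcoeff_map_derivation !mcoeffC.
by case: eqP => _; rewrite ?mulr1 ?mulr0 ?derivation0.
Qed.

Lemma map_derivationX i : map_mpoly delta 'X_i = 0 :> {mpoly K[n]}.
Proof.
apply/mpolyP => m; rewrite mcoeff_map_derivation mcoeff0 mcoeffX.
by case: eqP => _; rewrite ?derivation1 ?derivation0.
Qed.

Section TotalDerivative.
Variables (L : fieldType) (ev : {rmorphism {mpoly K[n]} -> L}) (u : 'I_n -> L).

(** The left-hand side of the equation of the prolongation attached to [f], with [u] for the
    coordinates [y]. *)
Definition total_derivative f :=
  \sum_(i < n) ev f^`M(i) * u i + ev (map_mpoly delta f).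

Lemma total_derivativeB f g :
  total_derivative (f - g) = total_derivative f - total_derivative g.
Proof.
rewrite /total_derivative map_derivationB rmorphB opprD addrACA -sumrB.
by congr (_ + _); apply: eq_bigr => i _; rewrite mderivB rmorphB mulrBl.
Qed.

Lemma total_derivativeM f g : total_derivative (f * g) =
  total_derivative f * ev g + ev f * total_derivative g.
Proof.
rewrite /total_derivative map_derivationM rmorphD !rmorphM mulrDl mulrDr.
rewrite addrACA mulr_suml mulr_sumr -big_split /=.
by congr (_ + _); apply: eq_bigr => i _; rewrite mderivM rmorphD !rmorphM /=; ring.
Qed.

Lemma total_derivativeC c : total_derivative c%:MP = ev (delta c)%:MP.
Proof.
rewrite /total_derivative map_derivationC big1 ?add0r // => i _.
by rewrite mderivC rmorph0 mul0r.
Qed.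

Lemma total_derivativeX k : total_derivative 'X_k = u k.
Proof.
rewrite /total_derivative map_derivationX rmorph0 addr0 (bigD1 k) //= big1.
  rewrite mderivX mnmE eqxx scale1r addr0.
  by rewrite (_ : (U_(k) - U_(k))%MM = 0%MM) ?mpolyX0 ?rmorph1 ?mul1r //;
     apply/mnmP => i; rewrite !mnmE subnn.
by move=> i nik; rewrite mderivX mnmE eq_sym (negPf nik) scale0r rmorph0 mul0r.
Qed.
End TotalDerivative.

Lemma chain_rule (L : fieldType) (deltaL : L -> L) (j : {rmorphism K -> L})
    (b : 'I_n -> L) (f : {mpoly K[n]}) :
  derivation deltaL -> (forall x, deltaL (j x) = j (delta x)) ->
  deltaL (mmap j b f) = total_derivative (mmap j b) (fun i => deltaL (b i)) f.
Proof.
move=> derL dj; have [dD dM] := derL.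
have TD g h : total_derivative (mmap j b) (fun i => deltaL (b i)) (g + h) =
    total_derivative (mmap j b) (fun i => deltaL (b i)) g +
    total_derivative (mmap j b) (fun i => deltaL (b i)) h.
  rewrite -{1}[h]opprK total_derivativeB -[- h]sub0r total_derivativeB.
  by rewrite -mpolyC0 total_derivativeC derivation0 mpolyC0 rmorph0 sub0r opprK.
elim/mpoly_closed_ind: f => [c|i|p q IHp IHq|p q IHp IHq].
- by rewrite total_derivativeC /= !mmapC dj.
- by rewrite total_derivativeX /= mmapX mmap1U.
- by rewrite TD rmorphD dD IHp IHq.
- by rewrite total_derivativeM rmorphM dM IHp IHq.
Qed.
End Derivations.

(** * Evaluation, composition and fractions *)

Section Composition.
Variables (K S : fieldType) (h : {rmorphism K -> S}).

Lemma mmap_comp_mpoly m n (z : 'I_m -> S) (phi : n.-tuple {mpoly K[m]})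
    (f : {mpoly K[n]}) :
  mmap h z (f \mPo phi) = mmap h (fun i => mmap h z (tnth phi i)) f.
Proof.
elim/mpoly_closed_ind: f => [c|i|p q IHp IHq|p q IHp IHq].
- by rewrite comp_mpolyC !mmapC.
- by rewrite comp_mpolyXU mmapX mmap1U (tnth_nth 0).
- by rewrite !rmorphD /= IHp IHq.
- by rewrite !rmorphM /= IHp IHq.
Qed.

Lemma mmap_proj_first n (z : 'I_(n + n) -> S) (f : {mpoly K[n]}) :
  mmap h z (f \mPo proj_first K n) = mmap h (fun i => z (lshift n i)) f.
Proof.
rewrite mmap_comp_mpoly; congr (mmap _ _ _); apply/funext => i.
by rewrite tnth_mktuple mmapX mmap1U.
Qed.

Lemma rmorph_mmap (T : fieldType) (g : {rmorphism S -> T}) n (z : 'I_n -> S)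
    (k : K -> T) (f : {mpoly K[n]}) : (forall c, k c = g (h c)) ->
  g (mmap h z f) = mmap k (fun i => g (z i)) f.
Proof.
move=> kE; rewrite (_ : k = g \o h); last exact/funext.
elim/mpoly_closed_ind: f => [c|i|p q IHp IHq|p q IHp IHq].
- by rewrite !mmapC.
- by rewrite !mmapX !mmap1U.
- by rewrite !rmorphD /= IHp IHq.
- by rewrite !rmorphM /= IHp IHq.
Qed.
End Composition.

Lemma fraction_numden (R : idomainType) (x : {fraction R}) :
  exists2 a : R * R, a.2 != 0 & x = FracField.tofrac a.1 / FracField.tofrac a.2.
Proof.
exists (frac (repr x)); first exact: denom_ratioP.
have nd := denom_ratioP (repr x).
apply: (canRL (mulfK _)); first by rewrite tofrac_eq0.
rewrite -{1}[x]reprK; unlock FracField.tofrac.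
rewrite -[LHS]FracField.pi_mul; apply/eqmodP; rewrite /= FracField.equivfE.
by rewrite /FracField.mulf !numden_Ratio ?oner_neq0 ?mulf_neq0 ?oner_neq0 //
  !mulr1 mulrC.
Qed.

Section RationalClass.
Variables (K : fieldType) (Omega : closedFieldType) (iota : {rmorphism K -> Omega}).
Variables (n : nat) (V : irr_variety iota n).

Fact rational_class_zmod_morphism : zmod_morphism (rational_class V).
Proof. by move=> f g; rewrite /rational_class !rmorphB. Qed.

Fact rational_class_monoid_morphism : monoid_morphism (rational_class V).
Proof. by split=> [|f g]; rewrite /rational_class ?rmorph1 ?rmorphM. Qed.

HB.instance Definition _ := GRing.isZmodMorphism.Build
  {mpoly K[n]} (function_field V) (rational_class V) rational_class_zmod_morphism.
HB.instance Definition _ := GRing.isMonoidMorphism.Build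
  {mpoly K[n]} (function_field V) (rational_class V) rational_class_monoid_morphism.

Lemma rational_class_eq0 f : rational_class V f = 0 <-> vanishing_ideal iota V f.
Proof.
have -> : (rational_class V f = 0) <-> (\pi f = 0 :> coord_ring V).
  by split=> [/eqP|fE]; rewrite /rational_class ?fE ?rmorph0 // tofrac_eq0 => /eqP.
split=> [/eqP|h].
  rewrite -[0](rmorph0 (\pi_(coord_ring V))) -Quotient.idealrBE subr0.
  by move/ideal_predP.
apply/eqP; rewrite -[0](rmorph0 (\pi_(coord_ring V))) -Quotient.idealrBE subr0.
exact/ideal_predP.
Qed.

Lemma rational_class_frac (x : function_field V) :
  exists f g, rational_class V g != 0 /\ x = rational_class V f / rational_class V g.
Proof.
have [[a b] /= nb ->] := fraction_numden x.
exists (repr a), (repr b); rewrite /rational_class !reprK; split=> //.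
by rewrite tofrac_eq0.
Qed.

Definition const_class (c : K) : function_field V := rational_class V c%:MP.
Fact const_class_zmod_morphism : zmod_morphism const_class.
Proof. by move=> a b; rewrite /const_class !rmorphB. Qed.

Fact const_class_monoid_morphism : monoid_morphism const_class.
Proof. by split=> [|a b]; rewrite /const_class ?rmorph1 ?rmorphM. Qed.

HB.instance Definition _ := GRing.isZmodMorphism.Build
  K (function_field V) const_class const_class_zmod_morphism.
HB.instance Definition _ := GRing.isMonoidMorphism.Build
  K (function_field V) const_class const_class_monoid_morphism.

Lemma mmap_rational_class f :
  mmap const_class (fun i => rational_class V 'X_i) f = rational_class V f.
Proof.
elim/mpoly_closed_ind: f => [c|i|p q IHp IHq|p q IHp IHq].
- by rewrite mmapC.
- by rewrite mmapX mmap1U.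
- by rewrite !rmorphD /= IHp IHq.
- by rewrite !rmorphM /= IHp IHq.
Qed.
End RationalClass.

(** * Jet points of separably differentially closed fields *)

(** One term serves for all [L], so that a formula true in [K(W)] can be read again in [K]. *)
Lemma jet_term (K : fieldType) n (g : {mpoly K[n + n]}) : exists t : dterm K,
  forall (L : fieldType) (deltaL : L -> L) (j : {rmorphism K -> L}) (e : nat -> L),
  deval deltaL j e t = mmap j (with_delta deltaL (fun i : 'I_n => e i)) g.
Proof.
elim/mpoly_closed_ind: g => [c|i|p q [s sE] [t tE]|p q [s sE] [t tE]].
- by exists (DConst c) => L dL j e; rewrite mmapC.
- exists (match split i with inl k => DVar K k | inr k => DDelta (DVar K k) end).
  by move=> L dL j e; rewrite mmapX mmap1U /with_delta; case: (split i).
- by exists (DAdd s t) => L dL j e; rewrite rmorphD /= sE tE.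
- by exists (DMul s t) => L dL j e; rewrite rmorphM /= sE tE.
Qed.

Lemma jet_formula (K : fieldType) n (s : seq {mpoly K[n + n]})
    (f : {mpoly K[n + n]}) : exists phi : dformula K,
  forall (L : fieldType) (deltaL : L -> L) (j : {rmorphism K -> L}) (e : nat -> L),
  let ev := mmap j (with_delta deltaL (fun i : 'I_n => e i)) in
  dholds deltaL j e phi <-> (forall g, g \in s -> ev g = 0) /\ ev f <> 0.
Proof.
elim: s => [|g s [phi phiP]].
  have [t tE] := jet_term f; exists (DNot (DEq t (DConst 0))) => L dL j e /=.
  by rewrite tE rmorph0; split=> [|[]].
have [t tE] := jet_term g; exists (DAnd (DEq t (DConst 0)) phi) => L dL j e /=.
rewrite tE rmorph0 phiP; split=> [[g0 [s0 f0]]|[s0 f0]].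
  by split=> // h; rewrite inE => /predU1P[->|/s0].
split; first by apply: s0; rewrite mem_head.
by split=> // h hs; apply: s0; rewrite inE hs orbT.
Qed.

(** * The generic point as a differential point *)

Section Forward.
Variables (K : fieldType) (delta : K -> K).
Variables (Omega : closedFieldType) (iota : {rmorphism K -> Omega}).
Hypothesis der : derivation delta.
Variables (n : nat) (V : irr_variety iota n) (W : irr_variety iota (n + n)).
Hypothesis WV : forall z, points W z -> prolongation iota delta (points V) z.
Hypothesis pi_separable : separable_morphism W V (proj_first K n).

Lemma image_proj_first (z : 'I_(n + n) -> Omega) :
  image_point iota (proj_first K n) z = fun i => z (lshift n i).
Proof. by apply/funext => i; rewrite /image_point tnth_mktuple mmapX mmap1U. Qed.

(** Dominance gives one direction, and that [W] maps into [V] the other; so [K(V)] embeds in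
    [K(W)]. *)
Lemma pullback_eq0 f :
  rational_class W (f \mPo proj_first K n) = 0 <-> vanishing_ideal iota V f.
Proof.
have [piWV dom _] := pi_separable.
split=> [/rational_class_eq0 f0|f0].
  apply: (dom (fun x => mmap iota x f = 0)) => [|z Wz].
    by exists (eq f) => x; split=> [h _ <-|]; [|apply].
  by rewrite image_proj_first -mmap_proj_first; apply: f0.
apply/rational_class_eq0 => z Wz; rewrite mmap_proj_first -image_proj_first.
by apply/f0/piWV.
Qed.

Lemma generic_derivation : exists2 D : function_field W -> function_field W,
  derivation D & (forall c, D (const_class W c) = const_class W (delta c)) /\
  forall i, D (rational_class W 'X_(lshift n i)) = rational_class W 'X_(rshift n i).
Proof.
have [piWV dom sep] := pi_separable.
pose ev : {rmorphism {mpoly K[n]} -> function_field W} :=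
  rational_class W \o comp_mpoly (proj_first K n).
pose y i := rational_class W 'X_(rshift n i).
pose T := total_derivative delta ev y.
have T0 f : ev f = 0 -> T f = 0.
  move=> /pullback_eq0 f0.
  (* The equation of the prolongation attached to [f], as a polynomial in all [n + n] variables: it
     vanishes on [W], and its class is [T f]. *)
  pose g := \sum_(i < n) (f^`M(i) \mPo proj_first K n) * 'X_(rshift n i) +
    (map_mpoly delta f \mPo proj_first K n).
  have -> : T f = rational_class W g.
    rewrite /T /total_derivative /g [RHS]rmorphD; congr (_ + _).
    rewrite rmorph_sum; apply: eq_bigr => i _.
    by rewrite rmorphM.
  apply/rational_class_eq0 => z Wz; have [_ <-] := WV Wz f0.
  rewrite rmorphD /= mmap_proj_first; congr (_ + _); rewrite rmorph_sum.
  by apply: eq_bigr => i _; rewrite rmorphM /= mmap_proj_first mmapX mmap1U.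
have pG := fraction_pder (total_derivativeB der ev y)
  (total_derivativeM der ev y) T0.
have [|D derD DE] := separable_derivation_extends pG.
  (* The domain of the partial derivation is exactly the pullback of [K(V)], over which [K(W)] is
     separable. *)
  suff -> : (fun x => exists d f g, [/\ ev g != 0, x * ev g = ev f &
      d * ev g + x * T g = T f]) = @pullback_field _ _ _ _ _ W V (proj_first K n) by [].
  apply/funext => x; apply/propext; split=> [[d [f [g [ng xg _]]]]|[f [g [ng ->]]]].
    exists f, g; split.
      by move/pullback_eq0/eqP; rewrite -[_ == _]/(ev g == 0) (negPf ng).
    by apply: (canRL (mulfK _)).
  have ng' : ev g != 0 by apply/eqP => /pullback_eq0.
  exists ((T f - ev f / ev g * T g) / ev g), f, g; split=> //.
    by rewrite divfK.
  by rewrite divfK // subrK.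
have evD f : D (ev f) = T f.
  apply: DE; exists f, 1; rewrite rmorph1 oner_neq0 !mulr1; split=> //.
  by rewrite -mpolyC1 total_derivativeC // derivation1 // mpolyC0 rmorph0 mulr0 addr0.
exists D => //; split=> [c|i].
  have -> : const_class W c = ev c%:MP by rewrite /= comp_mpolyC.
  by rewrite evD /T total_derivativeC //= comp_mpolyC.
have -> : rational_class W 'X_(lshift n i) = ev 'X_i.
  by rewrite /= comp_mpolyXU -tnth_nth tnth_mktuple.
by rewrite evD /T total_derivativeX.
Qed.

Hypothesis sepW : separable_variety W.
Hypothesis closedK : separably_differentially_closed delta.

Lemma closed_jet_point (OV : ('I_n -> Omega) -> Prop)
    (OW : ('I_(n + n) -> Omega) -> Prop) :
  nonempty_K_open iota V OV -> nonempty_K_open iota W OW ->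
  exists a : 'I_n -> K, OV (fun i => iota (a i)) /\
    OW (fun k => iota (with_delta delta a k)).
Proof.
have [piWV dom _] := pi_separable.
move=> [[x0 OVx0] [CV [SV SVE] OVE]] [[z0 OWz0] [CW [SW SWE] OWE]].
have [Vx0 nCx0] := (OVE x0).1 OVx0; have [Wz0 nCz0] := (OWE z0).1 OWz0.
have [f [SVf fx0]] : exists f, SV f /\ mmap iota x0 f <> 0.
  apply: contrapT => nof; apply/nCx0/SVE => f SVf; apply: contrapT => nf.
  by apply: nof; exists f.
have [h [SWh hz0]] : exists h, SW h /\ mmap iota z0 h <> 0.
  apply: contrapT => nof; apply/nCz0/SWE => h SWh; apply: contrapT => nh.
  by apply: nof; exists h.
pose f' := f \mPo proj_first K n.
(* Generators [s] of the ideal turn membership in [W] into finitely many equations, as a formula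
   requires. *)
have [|s sW sJ] := @noetherian_mpoly K (n + n) (vanishing_ideal iota W).
  split=> [x _|p q p0 q0 x Wx|p q q0 x Wx]; first by rewrite rmorph0.
    by rewrite rmorphD /= p0 // q0 // addr0.
  by rewrite rmorphM /= q0 // mulr0.
have [phi phiP] := jet_formula s (f' * h).
have [D derD [Dj Dx]] := generic_derivation.
(* The generic point as an assignment; variables from index [n] on get the value 0. *)
pose e k := if insub k is Some i then rational_class W 'X_(lshift n i) else 0.
have eE : with_delta D (fun i : 'I_n => e i) = fun k => rational_class W 'X_k.
  apply/funext => k; rewrite /with_delta /e.
  by case: split_ordP => i ->; rewrite valK // Dx.
have [|e' /(phiP K delta (idfun : {rmorphism K -> K})) [s0 fh0]] :=
    closedK derD Dj sepW (phi := phi).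
  exists e; apply/(phiP _ D (const_class W)) => /=; rewrite eE; split=> [g /sW g0|].
    by rewrite mmap_rational_class; apply/rational_class_eq0.
  rewrite mmap_rational_class rmorphM => /eqP; rewrite mulf_eq0 => /orP[]/eqP.
    by move/pullback_eq0/(_ _ Vx0).
  by move/rational_class_eq0/(_ _ Wz0).
pose a (i : 'I_n) := e' i; exists a.
pose z k := iota (with_delta delta a k).
have zE g : mmap iota z g = iota (mmap idfun (with_delta delta a) g).
  by rewrite (rmorph_mmap (h := idfun) _ _ (k := iota)).
have Wz : W z.
  have [[S SE] _ _] := points_irreducible W.
  (* The polynomials vanishing at [z] form an ideal that contains [s], hence the whole ideal of
     [W]. *)
  apply/SE => g Sg; apply: (sJ (fun g => mmap iota z g = 0)) => [|p /s0 p0|x /SE].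
  - split=> [|p q p0 q0|p q q0]; first by rewrite rmorph0.
      by rewrite rmorphD /= p0 q0 addr0.
    by rewrite rmorphM /= q0 mulr0.
  - by rewrite zE p0 rmorph0.
  - exact.
have zl : image_point iota (proj_first K n) z = fun i => iota (a i).
  rewrite image_proj_first; apply/funext => i; rewrite /z /with_delta.
  by rewrite (unsplitK (inl i)).
have nfh : mmap iota z (f' * h) <> 0.
  by move/eqP; rewrite zE fmorph_eq0 => /eqP.
split.
  apply/OVE; split; first by rewrite -zl; apply: piWV.
  move/SVE/(_ f SVf) => fa; apply: nfh.
  by rewrite rmorphM /= mmap_proj_first -image_proj_first zl fa mul0r.
apply/OWE; split=> // /SWE/(_ h SWh) ha; apply: nfh.
by rewrite rmorphM /= ha mulr0.
Qed.
End Forward.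

(** * Loci and generated fields *)

Section Locus.
Variables (K L : fieldType) (Omega : closedFieldType).
Variables (j : {rmorphism K -> L}) (iota : {rmorphism K -> Omega}).
Variables (n : nat) (c : 'I_n -> L).

(** The closure of [c] over [K], given by the specializations of [c] in [Omega]; [L] itself is not
    embedded in [Omega]. *)
Definition locus (z : 'I_n -> Omega) : Prop :=
  forall f, mmap j c f = 0 -> mmap iota z f = 0.

Lemma locus_vanishing f : vanishing_ideal iota locus f <-> mmap j c f = 0.
Proof.
split=> [f0|fc z]; last exact.
apply/eqP/negPn/negP => /(specialization iota)[z zP /eqP]; apply.
exact: f0.
Qed.

(** If neither closed set contains the locus, each has an equation that is nonzero at [c]; so is the
    product of the two, and some specialization avoids both sets. *)
Lemma locus_irreducible : K_irreducible iota locus.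
Proof.
split; first by exists (fun f => mmap j c f = 0).
  have [|z zP _] := @specialization _ _ _ j iota _ c 1; last by exists z.
  by rewrite rmorph1 oner_neq0.
move=> A B [SA SAE] [SB SBE] AB.
have notin S (C : ('I_n -> Omega) -> Prop) :
    (forall x, C x <-> forall f, S f -> mmap iota x f = 0) ->
    ~ (forall x, locus x -> C x) -> exists2 f, S f & mmap j c f != 0.
  move=> CE nC; apply: contrapT => nof; apply: nC => x Vx; apply/CE => f Sf.
  apply: Vx; apply/eqP/negPn/negP => nf; by apply: nof; exists f.
have [VA|/(notin _ _ SAE)[f Sf nf]] := pselect (forall x, locus x -> A x).
  by left.
have [VB|/(notin _ _ SBE)[g Sg ng]] := pselect (forall x, locus x -> B x).
  by right.
have [|z Vz] := @specialization _ _ _ j iota _ c (f * g).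
  by rewrite rmorphM mulf_neq0.
rewrite rmorphM; have [/SAE/(_ f Sf)/= ->|/SBE/(_ g Sg)/= ->] := AB z Vz.
  by rewrite mul0r eqxx.
by rewrite mulr0 eqxx.
Qed.

Definition locus_variety := IrrVariety locus_irreducible.

(** This identifies the function field of the locus with [K(c)] through polynomials, without
    building an isomorphism. *)
Lemma locus_class_eq f g :
  rational_class locus_variety f = rational_class locus_variety g <->
  mmap j c f = mmap j c g.
Proof.
have sub0 (T : zmodType) (x y : T) : x = y <-> x - y = 0.
  by split=> [->|/eqP]; rewrite ?subrr // subr_eq0 => /eqP.
by rewrite sub0 -rmorphB rational_class_eq0 locus_vanishing rmorphB -sub0.
Qed.

Lemma locus_class_eq0 f : (rational_class locus_variety f == 0) = (mmap j c f == 0).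
Proof.
apply/eqP/eqP => [/rational_class_eq0/locus_vanishing//|fc].
exact/rational_class_eq0/locus_vanishing.
Qed.

(** Separability passes from [L] to the subfield [K(c)]: a relation over [p]-th powers in the
    function field is moved into [L] after clearing denominators. *)
Lemma locus_separable :
  separable_over (fun z => exists a, z = j a) -> separable_variety locus_variety.
Proof.
set V := locus_variety => sepL p pV m b bK ind a aP ab i0.
have pL : p \in [pchar L].
  by rewrite (fmorph_pchar j) -(fmorph_pchar (const_class V)).
have p_gt0 := prime_gt0 (pcharf_prime pL).
pose k i := sval (cid (bK i)).
have kE i : b i = const_class V (k i) by rewrite /k; case: cid.
pose d i := sval (cid (aP i)).
have dE i : a i = d i ^+ p by rewrite /d; case: cid.
(* A common denominator of the [d i], the product of the individual ones. *)
have [g ng gP] : exists2 g, rational_class V g != 0 &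
    forall i, exists f, d i * rational_class V g = rational_class V f.
  have fr i := rational_class_frac (d i).
  pose f i := sval (cid (fr i)); pose g i := sval (cid (svalP (cid (fr i)))).
  have gE i : rational_class V (g i) != 0 /\
      d i = rational_class V (f i) / rational_class V (g i).
    exact: (svalP (cid (svalP (cid (fr i))))).
  exists (\prod_i g i).
    by rewrite rmorph_prod; apply/prodf_neq0 => l _; have [] := gE l.
  move=> l; exists (f l * \prod_(l' | l' != l) g l').
  rewrite (bigD1 l) //= !rmorphM /=; have [ng ->] := gE l.
  by rewrite mulrA divfK.
pose f i := sval (cid (gP i)).
have fE i : d i * rational_class V g = rational_class V (f i).
  by rewrite /f; case: cid.
have rel : \sum_i mmap j c (f i) ^+ p * j (k i) = 0.
  transitivity (mmap j c (\sum_i f i ^+ p * (k i)%:MP)).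
    rewrite rmorph_sum; apply: eq_bigr => l _.
    by rewrite rmorphM rmorphXn /= mmapC.
  apply/eqP; rewrite -locus_class_eq0 rmorph_sum /=; apply/eqP.
  transitivity (rational_class V g ^+ p * \sum_l a l * b l).
    rewrite mulr_sumr; apply: eq_bigr => l _.
    rewrite rmorphM rmorphXn /= -fE exprMn dE kE -/(const_class V (k l)).
    by rewrite mulrCA mulrA mulrC mulrA.
  by rewrite ab mulr0.
have jind : lin_indep (fun c => exists d, c = d ^+ p) (fun i => j (k i)).
  apply: sepL => // [l|x xP xk l0]; first by exists (k l).
  have xP' l : exists e, x l = j e ^+ p.
    by have [_ [e ->] ->] := xP l; exists e.
  pose e l := sval (cid (xP' l)).
  have eE l : x l = j (e l) ^+ p by rewrite /e; case: cid.
  have ek : \sum_l e l ^+ p * k l = 0.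
    apply: (fmorph_inj j); rewrite rmorph0 rmorph_sum -[RHS]xk.
    by apply: eq_bigr => l' _; rewrite rmorphM rmorphXn eE.
  have := ind (fun l => const_class V (e l) ^+ p) _ _ l0 => /=.
  rewrite eE => H; have /eqP : const_class V (e l0) ^+ p = 0.
    apply: H => [l'|].
      by exists (const_class V (e l')) => //; exists (e l').
    transitivity (const_class V (\sum_l e l ^+ p * k l)).
      rewrite rmorph_sum; apply: eq_bigr => l' _.
      by rewrite rmorphM rmorphXn kE.
    by rewrite ek rmorph0.
  rewrite expf_eq0 fmorph_eq0 => /andP[_ /eqP ->].
  by rewrite rmorph0 expr0n gtn_eqF.
have /eqP := jind (fun l => mmap j c (f l) ^+ p)
  (fun l => ex_intro _ (mmap j c (f l)) erefl) rel i0.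
rewrite expf_eq0 p_gt0 /= -locus_class_eq0 -/V -fE mulf_eq0 (negPf ng) orbF.
by move/eqP => di; rewrite dE di expr0n gtn_eqF.
Qed.
End Locus.

(** * The field [K(b)] *)

Section GeneratedField.
Variables (K L : fieldType) (j : {rmorphism K -> L}) (n : nat) (b : 'I_n -> L).

Definition generated_field (x : L) : Prop :=
  exists f g, mmap j b g != 0 /\ x * mmap j b g = mmap j b f.

Lemma generated_mmap f : generated_field (mmap j b f).
Proof. by exists f, 1; rewrite rmorph1 oner_neq0 mulr1. Qed.

Lemma generatedD x y :
  generated_field x -> generated_field y -> generated_field (x + y).
Proof.
move=> [f1 [g1 [n1 x1]]] [f2 [g2 [n2 x2]]].
exists (f1 * g2 + f2 * g1), (g1 * g2); split; first by rewrite rmorphM mulf_neq0.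
by rewrite rmorphD !rmorphM /= -x1 -x2; ring.
Qed.

Lemma generatedM x y :
  generated_field x -> generated_field y -> generated_field (x * y).
Proof.
move=> [f1 [g1 [n1 x1]]] [f2 [g2 [n2 x2]]].
exists (f1 * f2), (g1 * g2); split; first by rewrite rmorphM mulf_neq0.
by rewrite !rmorphM /= -x1 -x2; ring.
Qed.

Lemma generated0 : generated_field 0.
Proof. by rewrite -(rmorph0 (mmap j b)); apply: generated_mmap. Qed.

Lemma generatedN x : generated_field x -> generated_field (- x).
Proof.
rewrite -mulN1r; apply: generatedM.
by rewrite -(rmorphN1 (mmap j b)); apply: generated_mmap.
Qed.

Lemma generatedV x : generated_field x -> generated_field x^-1.
Proof.
have [->|nx] := eqVneq x 0; first by rewrite invr0.
move=> [f [g [ng xg]]]; exists g, f.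
by rewrite -xg mulf_neq0 // mulrA mulVf // mul1r.
Qed.

Lemma generated_sum (I : finType) (F : I -> L) :
  (forall i, generated_field (F i)) -> generated_field (\sum_i F i).
Proof.
move=> GF; apply: (big_ind generated_field) => [|x y|i _].
- exact: generated0.
- exact: generatedD.
- exact: GF.
Qed.

(* The values of a linear retraction of L onto the generated field. *)
Lemma affine_retraction m (v : 'I_m -> L) : exists2 u : 'I_m -> L,
  forall i, generated_field (u i) &
  forall c0 c, generated_field c0 -> (forall i, generated_field (c i)) ->
    c0 + \sum_i c i * v i = 0 -> c0 + \sum_i c i * u i = 0.
Proof.
elim: m v => [|m IHm] v.
  by exists (fun=> 0) => [i|c0 c _ _]; [apply: generated0 | rewrite !big_ord0].
have [u uF uP] := IHm (fun i => v (lift ord0 i)).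
pose ext w i := if unlift ord0 i is Some k then u k else w.
have extF w : generated_field w -> forall i, generated_field (ext w i).
  by move=> wF i; rewrite /ext; case: unliftP.
have ext_sum w (c : 'I_m.+1 -> L) : \sum_i c i * ext w i =
    c ord0 * w + \sum_i c (lift ord0 i) * u i.
  rewrite big_ord_recl /ext unlift_none; congr (_ + _).
  by apply: eq_bigr => i _; rewrite liftK.
(* If [v ord0] is an affine combination of the others, its image is forced. Otherwise a relation
   cannot have [c ord0] nonzero, so the image is free and 0 is taken. *)
pose dep := exists d0 d, [/\ generated_field d0, forall i, generated_field (d i) &
  v ord0 = d0 + \sum_i d i * v (lift ord0 i)].
have [[d0 [d [d0F dF vE]]]|nodep] := pselect dep.
  exists (ext (d0 + \sum_i d i * u i)) => [|c0 c c0F cF].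
    by apply: extF; apply: generatedD => //; apply: generated_sum => i;
      apply: generatedM.
  rewrite ext_sum big_ord_recl vE => rel.
  have := uP (c0 + c ord0 * d0) (fun i => c ord0 * d i + c (lift ord0 i)).
  have split_sum (w : 'I_m -> L) :
      \sum_i (c ord0 * d i + c (lift ord0 i)) * w i =
      c ord0 * (\sum_i d i * w i) + \sum_i c (lift ord0 i) * w i.
    by rewrite mulr_sumr -big_split; apply: eq_bigr => i _; rewrite mulrDl mulrA.
  rewrite !split_sum mulrDr !addrA => ->//.
  - by apply: generatedD => //; apply: generatedM.
  - by move=> i; apply: generatedD => //; apply: generatedM.
  - by rewrite -[RHS]rel mulrDr !addrA.
exists (ext 0) => [|c0 c c0F cF]; first by apply: extF; apply: generated0.
rewrite ext_sum big_ord_recl mulr0 add0r.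
have [->|nc] := eqVneq (c ord0) 0.
  by rewrite mul0r add0r; apply: uP.
move=> rel; case: nodep.
exists (- (c ord0)^-1 * c0), (fun i => - (c ord0)^-1 * c (lift ord0 i)).
split.
- by apply: generatedM => //; apply/generatedN/generatedV.
- by move=> i; apply: generatedM => //; apply/generatedN/generatedV.
- apply: (mulfI nc); rewrite mulrDr !mulrA mulrN divff // mulN1r.
  under eq_bigr => i _ do rewrite -mulrA.
  rewrite -mulr_sumr mulrA mulrN divff // mulN1r -opprD.
  by apply/eqP; rewrite -addr_eq0 addrCA rel.
Qed.
End GeneratedField.

(** * Transfer of quantifier-free formulas *)

Section FormulaTransfer.
Variables (K L : fieldType) (delta : K -> K) (deltaL : L -> L).
Variables (j : K -> L) (e : nat -> L).

Fixpoint subterm_values (t : dterm K) : seq L :=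
  deval deltaL j e t ::
  match t with
  | DVar _ | DConst _ => [::]
  | DAdd t1 t2 | DMul t1 t2 => subterm_values t1 ++ subterm_values t2
  | DOpp t1 | DInv t1 | DDelta t1 => subterm_values t1
  end.

Fixpoint formula_values (phi : dformula K) : seq L :=
  match phi with
  | DEq t1 t2 => subterm_values t1 ++ subterm_values t2
  | DNot phi1 => formula_values phi1
  | DAnd phi1 phi2 | DOr phi1 phi2 => formula_values phi1 ++ formula_values phi2
  end.

Lemma mem_subterm_values t : deval deltaL j e t \in subterm_values t.
Proof. by case: t => *; rewrite mem_head. Qed.

Variables (vals : seq L) (sigma : L -> K).
Hypothesis sigma_inj : {in vals &, injective sigma}.
Hypothesis sigmaC : forall c, j c \in vals -> sigma (j c) = c.
Hypothesis sigmaD : forall v w, v \in vals -> w \in vals -> v + w \in vals ->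
  sigma (v + w) = sigma v + sigma w.
Hypothesis sigmaN : forall v, v \in vals -> - v \in vals ->
  sigma (- v) = - sigma v.
Hypothesis sigmaM : forall v w, v \in vals -> w \in vals -> v * w \in vals ->
  sigma (v * w) = sigma v * sigma w.
Hypothesis sigmaV : forall v, v \in vals -> v^-1 \in vals ->
  sigma v^-1 = (sigma v)^-1.
Hypothesis sigma_delta : forall v, v \in vals -> deltaL v \in vals ->
  sigma (deltaL v) = delta (sigma v).

(** [sigma] is only assumed to respect operations whose arguments and value lie in [vals]; induction
    on [t] meets no others. *)
Lemma deval_transfer t : {subset subterm_values t <= vals} ->
  deval delta id (fun i => sigma (e i)) t = sigma (deval deltaL j e t).
Proof.
have hd (x : L) s : {subset x :: s <= vals} -> x \in vals /\ {subset s <= vals}.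
  by move=> H; split=> [|y ys]; apply: H; rewrite inE ?eqxx ?ys ?orbT.
have sub (s1 s2 : seq L) : {subset s1 ++ s2 <= vals} ->
    {subset s1 <= vals} /\ {subset s2 <= vals}.
  by move=> H; split=> y ys; apply: H; rewrite mem_cat ys ?orbT.
elim: t => [i|c|s IHs t IHt|t IHt|s IHs t IHt|t IHt|t IHt] //= /hd[].
- by move=> jc _; rewrite sigmaC.
- move=> st /sub[ss tt]; rewrite IHs // IHt // sigmaD //.
    exact/ss/mem_subterm_values.
  exact/tt/mem_subterm_values.
- move=> nt tt; rewrite IHt // sigmaN //; exact/tt/mem_subterm_values.
- move=> st /sub[ss tt]; rewrite IHs // IHt // sigmaM //.
    exact/ss/mem_subterm_values.
  exact/tt/mem_subterm_values.
- move=> nt tt; rewrite IHt // sigmaV //; exact/tt/mem_subterm_values.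
- move=> nt tt; rewrite IHt // sigma_delta //; exact/tt/mem_subterm_values.
Qed.

(** Injectivity of [sigma] on [vals] makes equations equivalent on both sides, which carries the
    induction through negations. *)
Lemma dholds_transfer phi : {subset formula_values phi <= vals} ->
  dholds delta id (fun i => sigma (e i)) phi <-> dholds deltaL j e phi.
Proof.
have sub (s1 s2 : seq L) : {subset s1 ++ s2 <= vals} ->
    {subset s1 <= vals} /\ {subset s2 <= vals}.
  by move=> H; split=> y ys; apply: H; rewrite mem_cat ys ?orbT.
elim: phi => [s t|phi IH|phi IH psi IH'|phi IH psi IH'] /=.
- move=> /sub[ss tt]; rewrite !deval_transfer //; split=> [|-> //].
  by apply: sigma_inj; [apply/ss/mem_subterm_values|apply/tt/mem_subterm_values].
- by move=> /IH ->.
- by move=> /sub[/IH -> /IH' ->].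
- by move=> /sub[/IH -> /IH' ->].
Qed.
End FormulaTransfer.

(** * Realizing formulas *)

Lemma fraction_expand (F : fieldType) (x y g h : F) : g != 0 -> h != 0 ->
  x / y = x * g * h / (g * (y * h)).
Proof.
by move=> ng nh; rewrite mulrCA -(mulrA x g h) -mulf_div divff ?mulr1 // mulf_neq0.
Qed.

Section Backward.
Variables (K L : fieldType) (delta : K -> K) (deltaL : L -> L).
Variables (j : {rmorphism K -> L}).
Variables (Omega : closedFieldType) (iota : {rmorphism K -> Omega}).
Hypothesis der : derivation delta.
Hypothesis derL : derivation deltaL.
Hypothesis deltaj : forall x, deltaL (j x) = j (delta x).
Variables (n : nat) (b u : 'I_n -> L).
Hypothesis uF : forall i, generated_field j b (u i).
Hypothesis uP : forall c0 c, generated_field j b c0 ->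
  (forall i, generated_field j b (c i)) ->
  c0 + \sum_i c i * deltaL (b i) = 0 -> c0 + \sum_i c i * u i = 0.

Definition jet (k : 'I_(n + n)) : L :=
  match split k with inl i => b i | inr i => u i end.

Lemma jetl i : jet (lshift n i) = b i.
Proof. by rewrite /jet (unsplitK (inl i)). Qed.

Lemma jetr i : jet (rshift n i) = u i.
Proof. by rewrite /jet (unsplitK (inr i)). Qed.

Lemma jet_proj f : mmap j jet (f \mPo proj_first K n) = mmap j b f.
Proof.
rewrite mmap_proj_first; congr (mmap _ _ _); apply/funext => i.
exact: jetl.
Qed.

Local Notation V := (locus_variety j iota b).
Local Notation W := (locus_variety j iota jet).

(** Differentiating [f(b) = 0] gives an affine relation over [K(b)] among the [deltaL (b i)]; by
    [uP] the [u i] satisfy it too. *)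
Lemma locus_prolongation z : points W z -> prolongation iota delta (points V) z.
Proof.
move=> Wz x y f /locus_vanishing fb; split.
  by rewrite -(mmap_proj_first iota z); apply: Wz; rewrite jet_proj.
pose g := \sum_(i < n) (f^`M(i) \mPo proj_first K n) * 'X_(rshift n i) +
  (map_mpoly delta f \mPo proj_first K n).
have gE (S : fieldType) (h : {rmorphism K -> S}) (w : 'I_(n + n) -> S) :
    mmap h w g = \sum_(i < n) mmap h (fun i => w (lshift n i)) f^`M(i) *
      w (rshift n i) + mmap h (fun i => w (lshift n i)) (map_mpoly delta f).
  rewrite rmorphD /= mmap_proj_first; congr (_ + _); rewrite rmorph_sum.
  by apply: eq_bigr => i _; rewrite rmorphM /= mmap_proj_first mmapX mmap1U.
rewrite -[LHS](gE _ iota z); apply: Wz; rewrite gE addrC.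
have -> : (fun i => jet (lshift n i)) = b by apply/funext => i; rewrite jetl.
under eq_bigr => i _ do rewrite jetr.
apply: uP; first exact: generated_mmap.
  by move=> i; apply: generated_mmap.
rewrite addrC -[LHS]/(total_derivative delta (mmap j b) (fun i => deltaL (b i)) f).
by rewrite -(chain_rule der b f derL deltaj) fb derivation0.
Qed.

(** The coordinates [u] lie in [K(b)], so every value at the jet is a fraction of values at [b]. *)
Lemma pullback_full x : @pullback_field _ _ _ _ _ W V (proj_first K n) x.
Proof.
have genW h : generated_field j b (mmap j jet h).
  elim/mpoly_closed_ind: h => [a|k|p q IHp IHq|p q IHp IHq].
  - by have := generated_mmap j b a%:MP; rewrite !mmapC.
  - rewrite mmapX mmap1U /jet; case: (split k) => i //.
    by have := generated_mmap j b 'X_i; rewrite mmapX mmap1U.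
  - by rewrite rmorphD; apply: generatedD.
  - by rewrite rmorphM; apply: generatedM.
have [h1 [h2 [nh2 ->]]] := rational_class_frac x.
have [f1 [g1 [ng1 e1]]] := genW h1; have [f2 [g2 [ng2 e2]]] := genW h2.
have nf2 : mmap j b f2 != 0.
  by rewrite -e2 mulf_neq0 //; move: nh2; rewrite locus_class_eq0.
exists (f1 * g2), (g1 * f2); split.
  by move/locus_vanishing/eqP; rewrite rmorphM mulf_eq0 (negPf ng1) (negPf nf2).
have cls h f g : mmap j jet h * mmap j b g = mmap j b f ->
    rational_class W h * rational_class W (g \mPo proj_first K n) =
    rational_class W (f \mPo proj_first K n).
  by move=> eq_hfg; rewrite -rmorphM; apply/locus_class_eq; rewrite rmorphM /= !jet_proj.
have npi g : mmap j b g != 0 -> rational_class W (g \mPo proj_first K n) != 0.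
  by rewrite locus_class_eq0 jet_proj.
rewrite !rmorphM /= -(cls _ _ _ e1) -(cls _ _ _ e2).
exact: fraction_expand (npi _ ng1) (npi _ ng2).
Qed.

Lemma locus_separable_morphism : separable_morphism W V (proj_first K n).
Proof.
split.
- move=> z Wz f fb; rewrite image_proj_first -mmap_proj_first; apply: Wz.
  by rewrite jet_proj.
- move=> C [S SE] CW x Vx; apply/SE => f Sf; apply: Vx; rewrite -jet_proj.
  apply/(locus_vanishing j iota jet) => z Wz.
  by rewrite mmap_proj_first -(image_proj_first iota); apply: ((SE _).1 (CW z Wz)).
- move=> p pL m c _ ind a aP; apply: ind => i.
  by have [d ->] := aP i; exists d => //; apply: pullback_full.
Qed.
End Backward.

(** * From rational points to existential closedness *)

Section Realization.
Variables (K : fieldType) (delta : K -> K).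
Variables (Omega : closedFieldType) (iota : {rmorphism K -> Omega}).
Hypothesis der : derivation delta.
Hypothesis geometric :
  forall (n : nat) (V : irr_variety iota n) (W : irr_variety iota (n + n)),
  (forall z, points W z -> prolongation iota delta (points V) z) ->
  separable_variety W -> separable_morphism W V (proj_first K n) ->
  forall (OV : ('I_n -> Omega) -> Prop) (OW : ('I_(n + n) -> Omega) -> Prop),
  nonempty_K_open iota (points V) OV -> nonempty_K_open iota (points W) OW ->
  exists a : 'I_n -> K, OV (fun i => iota (a i)) /\
    OW (fun k => iota (with_delta delta a k)).

Lemma realize_jet (L : fieldType) (deltaL : L -> L) (j : {rmorphism K -> L})
    n (b : 'I_n -> L) :
  derivation deltaL -> (forall x, deltaL (j x) = j (delta x)) ->
  separable_over (fun z => exists c, z = j c) ->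
  exists a : 'I_n -> K, [/\ injective b -> injective a,
    forall f, mmap j b f = 0 -> mmap idfun a f = 0 &
    forall i k, deltaL (b i) = b k -> delta (a i) = a k].
Proof.
move=> derL dj sepL.
have [u uF uP] := affine_retraction j b (fun i => deltaL (b i)).
pose V := locus_variety j iota b; pose W := locus_variety j iota (jet b u).
(* The open condition [sep <> 0] keeps distinct coordinates distinct. *)
pose sep : {mpoly K[n]} := \prod_(p : 'I_n * 'I_n | b p.1 != b p.2) ('X_p.1 - 'X_p.2).
have nsep : mmap j b sep != 0.
  rewrite rmorph_prod; apply/prodf_neq0 => p np.
  by rewrite rmorphB /= !mmapX !mmap1U subr_eq0.
pose OW z := W z /\ mmap iota z (sep \mPo proj_first K n) <> 0.
have [||a [_ [Wa asep]]] := geometric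
    (locus_prolongation (iota := iota) der derL dj uP)
    (locus_separable (iota := iota) (c := jet b u) sepL)
    (locus_separable_morphism iota uF) (OV := V) (OW := OW).
- split; first by have [] := points_irreducible V.
  exists (fun=> False); last by move=> x; split=> [Vx|[]]; [split|].
  exists (eq 1) => x; split=> // /(_ 1 erefl)/eqP.
  by rewrite rmorph1 oner_eq0.
- split; last first.
    exists (fun z => mmap iota z (sep \mPo proj_first K n) = 0) => //.
    exists (eq (sep \mPo proj_first K n)) => x.
    by split=> [h _ <-|]; [|apply].
  have [|z Wz /eqP zsep] :=
      @specialization _ _ _ j iota _ (jet b u) (sep \mPo proj_first K n).
    by rewrite jet_proj.
  by exists z.
pose z k := iota (with_delta delta a k).
have zE g : mmap iota z g = iota (mmap idfun (with_delta delta a) g).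
  by rewrite (rmorph_mmap (h := idfun) _ _ (k := iota)).
have al i : with_delta delta a (lshift n i) = a i.
  by rewrite /with_delta (unsplitK (inl i)).
have ar i : with_delta delta a (rshift n i) = delta (a i).
  by rewrite /with_delta (unsplitK (inr i)).
have aE f : mmap idfun (with_delta delta a) (f \mPo proj_first K n) = mmap idfun a f.
  rewrite (mmap_proj_first idfun); congr (mmap _ _ _); apply/funext => i.
  exact: al.
have zeros g : mmap j (jet b u) g = 0 -> mmap idfun (with_delta delta a) g = 0.
  by move=> /Wa/eqP; rewrite [mmap _ _ _]zE fmorph_eq0 => /eqP.
exists a; split.
- move=> binj i k aik; apply/eqP/negPn/negP => nik; apply: asep.
  rewrite [LHS]zE aE rmorph_prod /=.
  rewrite (bigD1 (i, k)) /=; last by apply: contraNneq nik => /binj ->.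
  by rewrite rmorphB /= !mmapX !mmap1U aik subrr mul0r rmorph0.
- by move=> f fb; rewrite -aE; apply: zeros; rewrite jet_proj.
- move=> i k bik.
  (* The affine relation [b k - deltaL (b i) = 0] has coefficients in [K(b)], so [uP] gives it for
     [u i]. Then ['X_(rshift n i) - 'X_(lshift n k)] vanishes at the jet, hence at
     [(a, delta a)]. *)
  have uik : u i = b k.
    have := uP (b k) (fun l => - (l == i)%:R).
    have pick (v : 'I_n -> L) : \sum_l - (l == i)%:R * v l = - v i.
      rewrite (bigD1 i) //= eqxx mulN1r big1 ?addr0 // => l /negPf ->.
      by rewrite oppr0 mul0r.
    rewrite !pick bik subrr => H; apply/esym/eqP; rewrite -subr_eq0; apply/eqP.
    apply: H => //.
      by have := generated_mmap j b 'X_k; rewrite mmapX mmap1U.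
    move=> l; apply: generatedN.
    by rewrite -(rmorph_nat (mmap j b)); apply: generated_mmap.
  have := zeros ('X_(rshift n i) - 'X_(lshift n k)).
  rewrite !rmorphB /= !mmapX !mmap1U jetl jetr uik subrr al ar => /(_ erefl)/eqP.
  by rewrite subr_eq0 => /eqP.
Qed.

Lemma geometric_closed : separably_differentially_closed delta.
Proof.
move=> L deltaL j derL dj sepL phi [e ephi].
(* Without duplicates [b] is injective, and then so is [a]. *)
pose vals := undup (formula_values deltaL j e phi).
pose b (i : 'I_(size vals)) := nth 0 vals i.
have [a [ainj azeros adelta]] := realize_jet b derL dj sepL.
have {}ainj : injective a.
  by apply: ainj => i k /eqP; rewrite nth_uniq ?undup_uniq // => /eqP/val_inj.
(* Sends the value [b i] to [a i]; the default 0 is met only outside [vals]. *)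
pose sigma v := if insub (index v vals) is Some i then a i else 0.
have sigmaP v : v \in vals -> exists2 i, v = b i & sigma v = a i.
  move=> vv; rewrite /sigma; case: insubP => [i _ iE|]; last by rewrite index_mem vv.
  by exists i => //; rewrite /b iE nth_index.
exists (fun i => sigma (e i)).
suff -> : dholds delta id (fun i => sigma (e i)) phi <-> dholds deltaL j e phi by [].
apply: (dholds_transfer (vals := vals)).
- move=> v w /sigmaP[i -> ->] /sigmaP[k -> ->] /ainj -> //.
- move=> c /sigmaP[i bi ->]; have := azeros ('X_i - c%:MP).
  rewrite !rmorphB /= !mmapX !mmap1U !mmapC -bi subrr => /(_ erefl)/eqP.
  by rewrite subr_eq0 => /eqP.
- move=> v w /sigmaP[i -> ->] /sigmaP[k -> ->] /sigmaP[l bl ->].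
  have := azeros ('X_i + 'X_k - 'X_l).
  rewrite !rmorphB !rmorphD /= !mmapX !mmap1U -bl subrr => /(_ erefl)/eqP.
  by rewrite subr_eq0 => /eqP.
- move=> v /sigmaP[i -> ->] /sigmaP[k bk ->].
  have := azeros ('X_i + 'X_k).
  rewrite !rmorphD /= !mmapX !mmap1U -bk subrr => /(_ erefl)/eqP.
  by rewrite addrC addr_eq0 => /eqP.
- move=> v w /sigmaP[i -> ->] /sigmaP[k -> ->] /sigmaP[l bl ->].
  have := azeros ('X_i * 'X_k - 'X_l).
  rewrite !rmorphB !rmorphM /= !mmapX !mmap1U -bl subrr => /(_ erefl)/eqP.
  by rewrite subr_eq0 => /eqP.
- move=> v /sigmaP[i -> ->] /sigmaP[k bk ->].
  (* The convention that the inverse of 0 is 0 is no polynomial relation such as ['X_i * 'X_k - 1],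
     so this case is separate. *)
  have [bi0|nbi] := eqVneq (b i) 0.
    have az l : b l = 0 -> a l = 0.
      by move=> bl; have := azeros 'X_l; rewrite !mmapX !mmap1U; apply.
    by rewrite !az ?invr0 // -bk bi0 invr0.
  have := azeros ('X_i * 'X_k - 1).
  rewrite !rmorphB !rmorphM !rmorph1 /= !mmapX !mmap1U -bk divff // subrr.
  move=> /(_ erefl)/eqP; rewrite subr_eq0 => /eqP ak.
  have nai : a i != 0 by apply: contra_eq_neq ak => ->; rewrite mul0r eq_sym oner_neq0.
  by apply: (mulfI nai); rewrite ak divff.
- by move=> v /sigmaP[i -> ->] /sigmaP[k bk ->]; rewrite (adelta i k).
- by move=> v; rewrite mem_undup.
Qed.
End Realization.

Theorem theorem4p10 (K : fieldType) (delta : K -> K)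
    (Omega : closedFieldType) (iota : {rmorphism K -> Omega}) :
  derivation delta ->
  separably_differentially_closed delta <->
  (forall (n : nat) (V : irr_variety iota n) (W : irr_variety iota (n + n)),
     (forall z, points W z -> prolongation iota delta (points V) z) ->
     separable_variety W ->
     separable_morphism W V (proj_first K n) ->
     forall (OV : ('I_n -> Omega) -> Prop) (OW : ('I_(n + n) -> Omega) -> Prop),
       nonempty_K_open iota (points V) OV ->
       nonempty_K_open iota (points W) OW ->
       exists a : 'I_n -> K,
         OV (fun i => iota (a i)) /\
         OW (fun k => iota (with_delta delta a k))).
Proof.
move=> der; split=> [closedK n V W WV sepW sepm OV OW|]; last exact: geometric_closed.
exact: (closed_jet_point der WV sepm sepW closedK).
Qed.
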